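(* Let $B$ be a triangulated $(d+1)$-ball. Then $B$ is $k$-shelled if and only if $B$ is shellable and $k$-stacked.
   Context: All simplicial complexes are finite and abstract, with the empty set as a face. A triangulated ball is a simplicial complex whose geometric carrier is homeomorphic to a ball. For a finite set $\alpha$, $\overline{\alpha}$ is the complex of all subsets of $\alpha$ and $\partial\alpha$ the complex of all proper subsets; $\dim\alpha=\#\alpha-1$. The join $X\ast Y$ (disjoint vertex sets) has as faces the disjoint unions of a face of $X$ and a face of $Y$. The standard ball $B^{d}_{d+1}$ is $\overline{\alpha}$ with $\#\alpha=d+1$. Complexes are identified up to isomorphism. Shelling moves: for pure $d$-dimensional complexes $Y\subseteq X$, $X$ is obtained from $Y$ by the shelling move $\alpha\leadsto\beta$ of index $\dim\beta$ if $\alpha$ and $\beta\ne\emptyset$ are disjoint faces of $X$, $\alpha\sqcup\beta$ is the only facet of $X$ that is not a facet of $Y$, and the set of faces of $Y$ contained in $\alpha\sqcup\beta$ is exactly $\overline\alpha\ast\partial\beta$ ($\alpha=\emptyset$ is allowed; if $\beta$ is a single vertex, it is not a vertex of $Y$). A $d$-dimensional complex is shellable if it is obtained from $B^d_{d+1}$ by a finite sequence of shelling moves. For $0\le k\le d$, a $d$-dimensional pseudomanifold is $k$-shelled if it is obtained from $B^d_{d+1}$ by a finite sequence of shelling moves each of index $<k$ ($B^d_{d+1}$ is the only $0$-shelled one). (A pseudomanifold is a pure complex in which each codimension-one face is in at most two facets and whose facets are connected via adjacency across codimension-one faces.) $\partial B$ is the pure subcomplex whose facets are the codimension-one faces lying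 in exactly one facet of $B$. For $0\le k\le d+1$, a triangulated $(d+1)$-ball $B$ is $k$-stacked if all faces of $B$ of dimension $\le d-k$ lie in $\partial B$. *)

(* Defs.v *)
From HB Require Import structures.
From mathcomp Require Import all_boot all_order all_algebra.

Set Implicit Arguments.
Unset Strict Implicit.
Unset Printing Implicit Defensive.

Import Order.TTheory GRing.Theory Num.Theory.

Local Open Scope ring_scope.

Section Combinatorics.
Variable V : finType.
Implicit Types (s t r a b : {set V}) (K X Y : {set {set V}}).
Local Open Scope set_scope.

(* A complex on V need not use every element of V: its vertices are the v such
   that [set v] is a face. *)
Definition simplicial_complex K : bool :=
  (set0 \in K) && [forall s in K, forall t : {set V}, (t \subset s) ==> (t \in K)].

(* Integer-valued, so that the empty face has dimension -1. *)
Definition dim s : int := #|s|%:Z - 1.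

Definition facets K : {set {set V}} := [set s | maxset (fun t => t \in K) s].

Definition pure_complex (n : nat) K : bool :=
  simplicial_complex K && [forall s in facets K, dim s == n%:Z].

(* The complex of all subsets of a; if #|a| = n + 1 it is the standard n-ball. *)
Definition full_simplex a : {set {set V}} := powerset a.

Definition simplex_boundary a : {set {set V}} := [set s : {set V} | s \proper a].

(* Only meaningful when X and Y have disjoint vertex sets. *)
Definition join X Y : {set {set V}} := [set s :|: t | s in X, t in Y].

Definition shelling_move (n : nat) Y X a b : bool :=
  [&& pure_complex n Y, pure_complex n X & Y \subset X] &&
  [&& a \in X, b \in X, b != set0 & [disjoint a & b]] &&
  (facets X :\: facets Y == [set a :|: b]) &&
  ([set s : {set V} in Y | s \subset a :|: b]
     == join (full_simplex a) (simplex_boundary b)).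

(* shelled_by n P X: X is obtained from the standard n-ball by a finite sequence
   of shelling moves all of whose indices satisfy P.  Every intermediate complex
   is a subcomplex of X, so the whole sequence can be labelled by V, the starting
   ball being then the full simplex on some n + 1 elements of V. *)
Inductive shelled_by (n : nat) (P : pred int) : {set {set V}} -> Prop :=
| shelled_start a : dim a = n%:Z -> shelled_by n P (full_simplex a)
| shelled_step Y X a b :
    shelled_by n P Y -> shelling_move n Y X a b -> P (dim b) ->
    shelled_by n P X.

Definition shellable (n : nat) K : Prop := shelled_by n predT K.

Definition facets_over K r : {set {set V}} := [set t : {set V} in facets K | r \subset t].

(* Faces of codimension one in an n-dimensional complex. *)
Definition ridges (n : nat) K : {set {set V}} :=
  [set r in K | dim r == n%:Z - 1].

Definition adjacent_facets (n : nat) K : rel {set V} := fun s t =>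
  [&& s \in facets K, t \in facets K &
      [exists r in ridges n K, (r \subset s) && (r \subset t)]].

Definition pseudomanifold (n : nat) K : bool :=
  [&& pure_complex n K,
      [forall r in ridges n K, (#|facets_over K r| <= 2)%N] &
      [forall s in facets K, forall t in facets K,
         connect (adjacent_facets n K) s t]].

Definition k_shelled (n k : nat) K : Prop :=
  pseudomanifold n K /\ shelled_by n (fun i => i < k%:Z) K.

(* All the faces, i.e. the subsets of the ridges lying in exactly one facet. *)
Definition boundary (n : nat) K : {set {set V}} :=
  [set s : {set V} | [exists r in ridges n K,
              (#|facets_over K r| == 1)%N && (s \subset r)]].

(* K is meant to be a (d+1)-ball. *)
Definition k_stacked (d k : nat) K : Prop :=
  forall s, s \in K -> dim s <= d%:Z - k%:Z -> s \in boundary d.+1 K.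

End Combinatorics.

From mathcomp Require Import all_classical all_reals all_analysis.
Import numFieldNormedType.Exports.

Section Geometry.
Variable R : realType.
Local Open Scope classical_set_scope.

(* The geometric carrier: barycentric coordinates, indexed by V through
   enum_rank, whose support is a face of K. *)
Definition carrier (V : finType) (K : {set {set V}}) : set 'rV[R]_#|V| :=
  [set x | (forall i, 0 <= x ord0 i) /\ \sum_i x ord0 i = 1 /\
           finset (fun v : V => x ord0 (enum_rank v) != 0) \in K].

(* The Euclidean ball; the norm of 'rV[R]_n is the sup norm. *)
Definition unit_ball (n : nat) : set 'rV[R]_n :=
  [set x | \sum_i x ord0 i ^+ 2 <= 1].

Definition homeomorphic (T U : topologicalType) (A : set T) (B : set U) : Prop :=
  exists (f : T -> U) (g : U -> T),
    [/\ {within A, continuous f}, {within B, continuous g},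
        f @` A `<=` B, g @` B `<=` A &
        {in A, cancel f g} /\ {in B, cancel g f}].

Definition triangulated_ball (V : finType) (n : nat) (K : {set {set V}}) : Prop :=
  simplicial_complex K /\ homeomorphic (carrier K) (@unit_ball n).

End Geometry.

(* Main.v *)
Require Import Defs.
From mathcomp Require Import all_boot all_order all_algebra.
From mathcomp Require Import all_classical all_reals all_analysis.
From mathcomp Require Import fintype finset fingroup perm.
From mathcomp Require Import zify ring lra.

(* Forward: an s of size <= d - k + 1 inside the new facet a :|: b of a move of
   index < k misses some v in a, and (a :|: b) :\ v is a boundary ridge over s.
   Backward: a move of index >= k would turn a small face a of the boundary into an
   interior face for good, because the ridges (a :|: b) :\ v, v in b, already form
   the whole boundary of the link of a. That the boundary of a link has no proper
   mod-2 subcycle is an induction along the shelling; it needs every ridge to lie in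
   at most two facets. This is the one topological input: three pages of a book do
   not embed in a Euclidean space of the same dimension. It follows from invariance
   of domain, derived from the Poincare-Miranda theorem, itself obtained from a
   cochain computation on the Freudenthal triangulation of a grid. *)

(** A shelling move does not by itself exclude branching: a ridge of the new facet that is already
    in [Y] may lie in two facets of [Y], hence in three of [X]. Topology rules this out for the ball
    [B], but the earlier complexes of the shelling are not known to be balls, so no topological
    statement about them or their links is available. Having at most two facets over each ridge is
    what passes from [X] down to [Y]. The ball hypothesis is therefore spent once, on [B] itself,
    and interior faces of the earlier complexes are handled by parity arguments alone. *)

Set Implicit Arguments.
Unset Strict Implicit.
Unset Printing Implicit Defensive.

Import Order.TTheory GRing.Theory Num.Theory.
Import numFieldNormedType.Exports.

(** * A discrete Poincare-Miranda theorem *)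

Section DiscretePoincareMiranda.
Local Open Scope ring_scope.
Variables (d N : nat).
Notation n := d.+1.
Notation pt := {ffun 'I_n -> nat}.
Notation cell := {ffun 'I_n -> 'I_N}.
Implicit Types (z : cell) (s : 'S_n) (chi : 'I_n -> pt -> int) (e : nat -> nat).

(* The vertices v_0, ..., v_n of the Freudenthal simplex of the cell z attached
   to s: the path from z to z + (1, ..., 1) raising coordinate m at step s m. *)
Definition vertex z s (i : nat) : pt := [ffun m => (z m + (s m < i))%N].

Definition jump chi z s (k : 'I_n) (i : nat) : int :=
  chi k (vertex z s i.+1) - chi k (vertex z s i).

(* The cup product of the dchi_k with its factor i replaced by the 0-cochain psi; e k
   is the vertex at which the factor k starts. *)
Definition gap_sum chi (i : 'I_n) (psi : pt -> int) e (p : nat) : int :=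
  \sum_(z : cell) \sum_(s : 'S_n) (-1) ^+ (s : bool) *
    (psi (vertex z s p) * \prod_(k | k != i) jump chi z s k (e k)).

(** Only v_(j+1) lies between the steps j and j+1, so only it depends on their order. *)
Lemma vertex_tperm z s (j i : nat) (j1 j2 : 'I_n) :
  val j1 = j -> val j2 = j.+1 -> i != j.+1 ->
  vertex z (s * tperm j1 j2) i = vertex z s i.
Proof.
rewrite /= => e1 e2 ij; apply/ffunP => m; rewrite !ffunE permM; congr (_ + nat_of_bool _)%N.
by case: tpermP => [->|->|_ _] //; lia.
Qed.

Lemma alternating_sum0 (F : 'S_n -> int) (t : 'S_n) :
  odd_perm t -> (forall s, F (s * t)%g = F s) ->
  \sum_(s : 'S_n) (-1) ^+ (s : bool) * F s = 0.
Proof.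
move=> ot Ft; set S := LHS.
suff : S = - S by lia.
rewrite {1}/S (reindex_inj (mulIg t)) /= -sumrN; apply: eq_bigr => s _.
by rewrite Ft odd_permM ot addbT signrN mulNr.
Qed.

(* Adding the two sums merges the two jumps of chi j into one from v_g to v_(g+2);
   v_(g+1) then plays no role, and the simplices differing there cancel in pairs. *)
Lemma gap_sum_swap chi i psi e e' p (j : 'I_n) g :
  j != i -> (g.+1 < n)%N -> p != g.+1 -> e j = g -> e' j = g.+1 ->
  (forall k : 'I_n, k != j -> k != i ->
     [/\ e' k = e k, e k != g & e k != g.+1]) ->
  gap_sum chi i psi e p = - gap_sum chi i psi e' p.
Proof.
move=> ji jn pj ej e'j He; apply/eqP; rewrite -addr_eq0; apply/eqP.
rewrite -big_split /=; apply: big1 => z _; rewrite -big_split /=.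
pose F (s : 'S_n) := psi (vertex z s p) *
  ((\prod_(k | (k != i) && (k != j)) jump chi z s k (e k)) *
   (chi j (vertex z s g.+2) - chi j (vertex z s g))).
rewrite (eq_bigr (fun s : 'S_n => (-1) ^+ (s : bool) * F s)); last first.
  move=> s _; rewrite -mulrDr; congr (_ * _); rewrite -mulrDr /F; congr (_ * _).
  rewrite (bigD1 j) //= [in X in _ + X](bigD1 j) //= ej e'j.
  rewrite [in X in _ + X](eq_bigr (fun k => jump chi z s k (e k))); last first.
    by move=> k /andP[ki kj]; have [-> _ _] := He k kj ki.
  by rewrite /jump; ring.
pose g1 : 'I_n := Ordinal (ltnW jn); pose g2 : 'I_n := Ordinal jn.
apply: (@alternating_sum0 F (tperm g1 g2)).
  by rewrite odd_tperm; apply/eqP => /(congr1 val) /=; lia.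
have V s q : q != g.+1 -> vertex z (s * tperm g1 g2)%g q = vertex z s q.
  by move=> qj; apply: (@vertex_tperm z s g).
have g2g : g.+2 != g.+1 by lia.
have gg1 : g != g.+1 by lia.
move=> s; rewrite /F !V //.
congr (_ * (_ * _)); apply: eq_bigr => k /andP[ki kj].
have [_ h1 h2] := He k kj ki.
by rewrite /jump !V //; lia.
Qed.

Lemma gap_sum_eq chi i psi e e' p :
  (forall k : 'I_n, k != i -> e k = e' k) -> gap_sum chi i psi e p = gap_sum chi i psi e' p.
Proof.
move=> ee; apply: eq_bigr => z _; apply: eq_bigr => s _; congr (_ * (_ * _)).
by apply: eq_bigr => k ki; rewrite ee.
Qed.

Lemma gap_sum_left chi (i : 'I_n) psi :
  gap_sum chi i psi id i.+1
  = (-1) ^+ i * gap_sum chi i psi (fun k => k + (k < i))%N i.+1.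
Proof.
have H j : (j <= i)%N ->
  gap_sum chi i psi id i.+1
  = (-1) ^+ j * gap_sum chi i psi (fun k => k + ((i - j <= k) && (k < i)))%N i.+1.
  elim: j => [|j IH] ji.
    by rewrite mul1r; apply: gap_sum_eq => k ki; lia.
  rewrite IH ?(ltnW ji) // exprS mulN1r mulNr -mulrN; congr (_ * _).
  have jn : (i - j.+1 < n)%N by have := ltn_ord i; lia.
  have ltin := ltn_ord i.
  apply: (@gap_sum_swap _ _ _ _ _ _ (Ordinal jn) (i - j.+1)) => /=; try lia.
  - by apply/eqP => /(congr1 val) /=; lia.
  - move=> k kj ki; have : val k != (i - j.+1)%N by apply: contraNneq kj => h; apply/eqP/val_inj.
    have : val k != val i by [].
    by move=> /= h1 h2; split; lia.
rewrite (H i) //; congr (_ * _); apply: gap_sum_eq => k ki; lia.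
Qed.

Lemma gap_sum_right chi (i : 'I_n) psi :
  gap_sum chi i psi id i
  = (-1) ^+ (d - i) * gap_sum chi i psi (fun k => k - (i < k))%N i.
Proof.
have H j : (j <= d - i)%N ->
  gap_sum chi i psi id i
  = (-1) ^+ j * gap_sum chi i psi (fun k => k - ((i < k) && (k <= i + j)))%N i.
  elim: j => [|j IH] ji.
    by rewrite mul1r; apply: gap_sum_eq => k ki; lia.
  rewrite IH ?(ltnW ji) // exprS mulN1r mulNr -mulrN; congr (_ * _).
  have ltin := ltn_ord i.
  have jn : ((i + j).+1 < n)%N by lia.
  apply: oppr_inj; rewrite opprK; symmetry.
  apply: (@gap_sum_swap _ _ _ _ _ _ (Ordinal jn) (i + j)) => /=; try lia.
  - by apply/eqP => /(congr1 val) /=; lia.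
  - move=> k kj ki; have : val k != (i + j).+1 by apply: contraNneq kj => h; apply/eqP/val_inj.
    have : val k != val i by [].
    by move=> /= h1 h2; split; lia.
rewrite (H (d - i)%N) //; congr (_ * _); apply: gap_sum_eq => k ki.
by have := ltn_ord k; lia.
Qed.

(** Raising coordinate m in the base point replaces the first step of the path, which is then taken
    last. *)
Lemma vertex_rot z s (m : 'I_n) (j : nat) :
  s m = ord0 -> (j <= d)%N -> ((z m).+1 < N)%N ->
  vertex [ffun k => if k == m then ordS (z k) else z k]
    (s * lift_perm ord0 ord_max 1) j = vertex z s j.+1.
Proof.
move=> sm jd zm; apply/ffunP => k; rewrite !ffunE permM.
have [->|km] := eqVneq k m.
  by rewrite sm lift_perm_id /= modn_small //; lia.
have sk : ord0 != s k by rewrite -sm (inj_eq perm_inj) eq_sym.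
case: (unliftP ord0 (s k)) sk => [l ->|->]; last by rewrite eqxx.
rewrite lift_perm_lift perm1 /= /bump leq0n; have := ltn_ord l; lia.
Qed.

Definition boundary_values chi :=
  forall k (x : pt), (x k = 0%N -> chi k x = 0) /\ (x k = N -> chi k x = 1).

(** All the vertices that are read lie in one face x_m = c of the grid. There [psi] vanishes if m =
    i; otherwise [chi m] is constant and its jump vanishes. *)
Lemma gap_term0 chi (i : 'I_n) (psi : pt -> int) z s p (e : 'I_n -> nat) (m : 'I_n) c :
  boundary_values chi ->
  (forall x : pt, x i = 0%N \/ x i = N -> psi x = 0) ->
  c = 0%N \/ c = N -> vertex z s p m = c ->
  (forall k : 'I_n, k != i ->
     vertex z s (e k) m = c /\ vertex z s (e k).+1 m = c) ->
  psi (vertex z s p) * (\prod_(k | k != i) jump chi z s k (e k)) = 0.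
Proof.
move=> Hchi Hpsi Hc pm em; have [mi|mi] := eqVneq m i.
  by rewrite Hpsi ?mul0r // -mi pm.
have [e1 e2] := em _ mi; rewrite (bigD1 m) //= /jump.
have -> : chi m (vertex z s (e m).+1) = chi m (vertex z s (e m)).
  have [h1 h2] := Hchi m (vertex z s (e m)).
  have [h3 h4] := Hchi m (vertex z s (e m).+1).
  by case: Hc => cE; rewrite cE in e1 e2; [rewrite (h1 e1) (h3 e2)|rewrite (h2 e1) (h4 e2)].
by rewrite subrr mul0r mulr0.
Qed.

(* Moving the first step of a path to its end permutes the simplices, except at the
   boundary cells, where the summand vanishes. *)
Lemma gap_sum_rotate chi (i : 'I_n) psi :
  boundary_values chi -> (forall x : pt, x i = 0%N \/ x i = N -> psi x = 0) ->
  gap_sum chi i psi (fun k => k + (k < i))%N i.+1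
  = (-1) ^+ d * gap_sum chi i psi (fun k => k - (i < k))%N i.
Proof.
move=> Hchi Hpsi.
rewrite /gap_sum exchange_big [in RHS]exchange_big /= mulr_sumr.
(* [r] sends step 0 to the last step and each step l+1 to l: a cycle of length d+1, of sign
   (-1)^d. *)
pose r : 'S_n := lift_perm ord0 ord_max 1.
rewrite [RHS](reindex_inj (mulIg r)) /=; apply: eq_bigr => s _.
have [m sm] : exists m, s m = ord0 by exists (s^-1%g ord0); rewrite permKV.
(* The translation by one in direction m wraps around, which keeps it a bijection of the cells; the
   wrapped cells contribute 0 on both sides. *)
pose sh z : cell := [ffun k => if k == m then ordS (z k) else z k].
have sh_inj : injective sh.
  move=> z z' /ffunP E; apply/ffunP => k; have := E k; rewrite !ffunE.
  by case: ifP => // _ /(bij_inj (@ordS_bij N)).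
rewrite mulr_sumr [RHS](reindex_inj sh_inj) /=; apply: eq_bigr => z _.
rewrite odd_permM /r odd_lift_perm odd_perm1 /= addbF signr_addb.
rewrite signr_odd mulrA.
congr (_ * _); first by rewrite mulrCA -expr2 sqrr_sign mulr1.

have ltin := ltn_ord i; have ltzm := ltn_ord (z m).
have [zm|zm] := ltnP (z m).+1 N; last first.
  (* Now [z m] is N-1. On the left the vertices read come after step 0, so their coordinate m is N;
     on the right they precede the last step, so it is 0. *)
  transitivity (0 : int); last symmetry.
  - apply: (gap_term0 (m := m) (c := N) Hchi Hpsi); first by right.
      by rewrite ffunE sm /=; lia.
    move=> k ki; have : val k != val i by [].
    by rewrite !ffunE sm /=; split; lia.
  - apply: (gap_term0 (m := m) (c := 0%N) Hchi Hpsi); first by left.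
      rewrite ffunE permM sm lift_perm_id ffunE eqxx /=.
      have -> : (z m).+1 = N by lia.
      by rewrite modnn; lia.
    move=> k ki; have ltkn := ltn_ord k; have : val k != val i by [].
    rewrite /= !ffunE permM sm lift_perm_id eqxx /=.
    have -> : (z m).+1 = N by lia.
    by rewrite modnn; split; lia.
have V j : (j <= d)%N -> vertex (sh z) (s * r) j = vertex z s j.+1 by move=> jd; exact: vertex_rot.
rewrite V //; congr (_ * _); apply: eq_bigr => k ki.
have ltkn := ltn_ord k; have : val k != val i by [].
move=> /= ki'; rewrite /jump !V; try lia.
by have -> : (k + (k < i) = (k - (i < k)).+1)%N by lia.
Qed.

(** The cup product of all the dchi_k on the fundamental chain of the grid; the sign of [s] is the
    orientation of its simplex. *)
Definition total chi : int :=
  \sum_(z : cell) \sum_(s : 'S_n) (-1) ^+ (s : bool) * \prod_k jump chi z s k k.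

(** A discrete Stokes formula: the difference has the factor dpsi with psi = chi_i - chi'_i zero on
    the faces x_i = 0 and x_i = N. Its two terms, psi at v_(i+1) and psi at v_i, are carried to each
    other by the shifts and the rotation, with equal signs since i + d and d - i have the same
    parity. *)
Lemma total_eq chi chi' (i : 'I_n) :
  boundary_values chi -> boundary_values chi' ->
  (forall k, k != i -> chi k = chi' k) -> total chi = total chi'.
Proof.
move=> Hchi Hchi' chiE; pose psi x := chi i x - chi' i x.
have Hpsi (x : pt) : x i = 0%N \/ x i = N -> psi x = 0.
  have [h1 h2] := Hchi i x; have [h3 h4] := Hchi' i x.
  by rewrite /psi; case=> xi; [rewrite h1 ?h3|rewrite h2 ?h4].
suff : total chi - total chi' = gap_sum chi i psi id i.+1 - gap_sum chi i psi id i.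
  rewrite gap_sum_left gap_sum_rotate // gap_sum_right mulrA -exprD.
  have id' : (i <= d)%N by rewrite -ltnS.
  have -> : (-1 : int) ^+ (i + d) = (-1) ^+ (d - i).
    have -> : (i + d = d - i + 2 * i)%N by lia.
    by rewrite exprD exprM sqrrN !expr1n mulr1.
  by rewrite subrr => /eqP; rewrite subr_eq0 => /eqP.
rewrite /total /gap_sum -!sumrB; apply: eq_bigr => z _.
rewrite -!sumrB; apply: eq_bigr => s _; rewrite -!mulrBr; congr (_ * _).
rewrite -mulrBl (bigD1 i) //= [in X in _ - X](bigD1 i) //=.
rewrite [in X in _ - X](eq_bigr (fun k => jump chi z s k k)); last first.
  by move=> k ki; rewrite /jump chiE.
by rewrite /jump /psi; ring.
Qed.

Definition step_fun (k : 'I_n) (x : pt) : int := (0 < x k)%N%:R.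

Lemma step_boundary : (0 < N)%N -> boundary_values step_fun.
Proof. by move=> N0 k x; rewrite /step_fun; split=> ->; rewrite ?N0. Qed.

(** Factor k is nonzero only if coordinate k starts at 0 and is raised at step k, which leaves the
    single simplex z = 0, s = 1. *)
Lemma total_step : (0 < N)%N -> total step_fun = 1.
Proof.
move=> N0; pose z0 : cell := [ffun => Ordinal N0].
have jumpE z s k : jump step_fun z s k k = ((z k == 0 :> nat) && (s k == k))%:R.
  rewrite /jump /step_fun !ffunE -val_eqE /=; case: (z k) => [[|zk] ?] //=.
  rewrite !add0n !lt0b ltnS [(s k <= k)%N]leq_eqVlt.
  by case: eqP => [->|_]; rewrite ?ltnn //; case: (s k < k)%N.
rewrite /total (bigD1 z0) //= (bigD1 1%g) //= odd_perm1 mul1r.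
rewrite big1 => [|k _]; last by rewrite jumpE ffunE perm1 /= eqxx.
rewrite big1 => [|s sN1]; last first.
  have [k sk] : exists k, s k != k.
    apply/existsP; rewrite -negb_forall; apply: contra sN1 => /forallP h.
    by apply/eqP/permP => k; rewrite perm1; apply/eqP; exact: h.
  by rewrite (bigD1 k) //= jumpE (negbTE sk) andbF mul0r mulr0.
rewrite big1 => [|z zN]; first by rewrite !addr0.
have [k zk] : exists k, z k != 0 :> nat.
  apply/existsP; rewrite -negb_forall; apply: contra zN => /forallP h.
  apply/eqP/ffunP => k; rewrite ffunE; apply/val_inj/eqP.
  exact: h.
by rewrite big1 // => s _; rewrite (bigD1 k) //= jumpE (negbTE zk) mul0r mulr0.
Qed.

(** The [chi k] are exchanged for step functions one at a time. *)
Lemma total_eq1 chi : (0 < N)%N -> boundary_values chi -> total chi = 1.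
Proof.
move=> N0 Hchi; pose mix j (k : 'I_n) := if (k < j)%N then step_fun k else chi k.
have Hmix j : boundary_values (mix j).
  by move=> k x; rewrite /mix; case: ifP => _; [exact: step_boundary|exact: Hchi].
have mixE j : (j <= n)%N -> total chi = total (mix j).
  elim: j => [//|j IH] jn; rewrite IH ?(ltnW jn) //.
  apply: (@total_eq _ _ (Ordinal jn)) => // k kj; rewrite /mix ltnS [(k <= j)%N]leq_eqVlt.
  by rewrite -val_eqE /= in kj; rewrite (negbTE kj).
rewrite (mixE n) // -[RHS]total_step //; congr total.
by apply/funext => k; rewrite /mix ltn_ord.
Qed.

(* The cochain dchi_1 \cup ... \cup dchi_n has total mass 1, so it is nonzero on
   some simplex. *)
Lemma discrete_poincare_miranda (P : 'I_n -> pred pt) : (0 < N)%N ->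
  (forall k (x : pt), x k = 0%N -> ~~ P k x) -> (forall k (x : pt), x k = N -> P k x) ->
  exists z : cell, forall k : 'I_n, exists x y : pt,
    [/\ forall m, z m <= x m <= (z m).+1, forall m, z m <= y m <= (z m).+1,
        ~~ P k x & P k y]%N.
Proof.
move=> N0 P0 P1; pose chi k x : int := (P k x)%:R.
have Hchi : boundary_values chi.
  by move=> k x; split=> xk; rewrite /chi; [rewrite (negbTE (P0 _ _ xk))|rewrite P1].
have [z /existsP[s /forallP zs]] :
    exists z, [exists s : 'S_n, [forall k, jump chi z s k k != 0]].
  apply/existsP; have := total_eq1 N0 Hchi; apply: contra_eqT.
  rewrite negb_exists => /forallP h.
  rewrite /total big1 // => z _; rewrite big1 // => s _.
  have := h z; rewrite negb_exists => /forallP /(_ s).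
  rewrite negb_forall => /existsP[k]; rewrite negbK => /eqP jk.
  by rewrite (bigD1 k) //= jk mul0r mulr0.
have V i m : (z m <= vertex z s i m <= (z m).+1)%N by rewrite ffunE; lia.
exists z => k; have := zs k; rewrite /jump /chi.
have [Pk1|Pk1] := boolP (P k (vertex z s k.+1)); have [Pk|Pk] := boolP (P k (vertex z s k)) => //= _.
  by exists (vertex z s k), (vertex z s k.+1).
by exists (vertex z s k.+1), (vertex z s k).
Qed.

End DiscretePoincareMiranda.

(** * Invariance of domain *)

Section RowVectors.
Local Open Scope classical_set_scope.
Local Open Scope ring_scope.
Variable R : realType.

Lemma norm_coord n (x : 'rV[R]_n) i : `|x ord0 i| <= `|x|.
Proof.
rewrite [leRHS]/Num.norm /= mx_normrE.
exact: (le_bigmax _ (fun ij => `|x ij.1 ij.2|) (ord0, i)).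
Qed.

Lemma norm_le n (x : 'rV[R]_n) e :
  0 <= e -> (forall i, `|x ord0 i| <= e) -> `|x| <= e.
Proof.
move=> e0 xe; rewrite [leLHS]/Num.norm /= mx_normrE.
by apply/bigmax_leP; split => // -[i j] _ /=; rewrite (ord1 i).
Qed.

Lemma norm_attained n (x : 'rV[R]_n) : `|x| != 0 -> exists i, `|x| = `|x ord0 i|.
Proof.
move=> /(@mx_norm_neq0 R 1 n x)[[i j] /= xij].
by exists j; rewrite [LHS]xij (ord1 i).
Qed.

Definition cont_on m n (A : set 'rV[R]_m) (f : 'rV[R]_m -> 'rV[R]_n) :=
  forall x, A x -> forall e, 0 < e ->
    exists2 de, 0 < de & forall y, A y -> `|y - x| < de -> `|f y - f x| < e.

Lemma within_cont_on m n (A : set 'rV[R]_m) (f : 'rV[R]_m -> 'rV[R]_n) :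
  {within A, continuous f} -> cont_on A f.
Proof.
move/subspace_continuousP => fc x Ax e e0.
have := @cvgr_dist_lt _ _ _ _ _ _ _ (fc x Ax) e e0.
move=> h; have {}h := h (within_filter A (nbhs_filter x)).
move: h; rewrite near_withinE => /nbhs_normP[de /= de0 H].
exists de => // y Ay yx; rewrite distrC; apply: H => //=.
by rewrite distrC.
Qed.

Lemma cont_on_comp m n p (A : set 'rV[R]_m) (B : set 'rV[R]_n)
    (f : 'rV[R]_m -> 'rV[R]_n) (g : 'rV[R]_n -> 'rV[R]_p) :
  (forall x, A x -> B (f x)) -> cont_on A f -> cont_on B g -> cont_on A (g \o f).
Proof.
move=> AB fc gc x Ax e /(gc _ (AB _ Ax))[de de0 H].
have [eta eta0 H'] := fc _ Ax _ de0.
by exists eta => // y Ay yx; apply: H; [exact: AB|exact: H'].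
Qed.

Local Notation Q n := [set x : 'rV[R]_n | `|x| <= 1].

Lemma cube_cluster n (u : nat -> 'rV[R]_n) : (forall N, Q n (u N)) ->
  exists2 x, Q n x & forall e, 0 < e -> forall M, exists2 N, (M <= N)%N & `|u N - x| < e.
Proof.
move=> uQ; have Qc : compact (Q n).
  have -> : Q n = [set x : 'rV[R]_n | forall i, `[-1, 1]%classic (x ord0 i)].
    apply/seteqP; split => x /= xQ.
      by move=> i; rewrite in_itv /= -ler_norml (le_trans (norm_coord x i)).
    by apply: norm_le => // i; have := xQ i; rewrite in_itv /= -ler_norml.
  apply: (@rV_compact R n (fun=> `[-1 : R, 1]%classic)) => _; exact: segment_compact.
have FQ : (u @ \oo) (Q n) by exists 0%N => // N _; exact: uQ.
have [x [xQ xc]] := Qc (u @ \oo) _ FQ.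
exists x => // e e0 M.
have FM : (u @ \oo) [set y | exists2 N, (M <= N)%N & y = u N].
  by exists M => // N /= MN; exists N.
have [y [[N MN ->] yx]] := xc _ _ FM (nbhsx_ballx x e e0).
by exists N => //; move: yx; rewrite -ball_normE /= distrC.
Qed.

Lemma cluster_small_index (e : R) : 0 < e -> exists M : nat, forall N, (M <= N)%N -> N.+1%:R^-1 < e.
Proof.
move=> e0; have [M _ H] := near_infty_natSinv_lt (PosNum e0).
by exists M => N MN; apply: H.
Qed.

(** * The continuous Poincare-Miranda theorem *)

Lemma sign_change_cell d (H : 'rV[R]_d.+1 -> 'rV[R]_d.+1) (N : nat) :
  (forall x i, Q _ x -> x ord0 i = -1 -> H x ord0 i < 0) ->
  (forall x i, Q _ x -> x ord0 i = 1 -> 0 < H x ord0 i) ->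
  exists2 u, Q _ u & forall k, exists x y : 'rV[R]_d.+1,
    [/\ Q _ x, Q _ y, `|x - u| <= 2 * N.+1%:R^-1 /\ `|y - u| <= 2 * N.+1%:R^-1,
        H x ord0 k <= 0 & 0 < H y ord0 k].
Proof.
move=> Hneg Hpos; have N0 : 0 < N.+1%:R :> R by rewrite ltr0n.
(* The grid of mesh 2/(N+1) on the cube; [minn] clamps it, so that [g p] is in the cube for every
   [p]. *)
pose g (p : {ffun 'I_d.+1 -> nat}) : 'rV[R]_d.+1 :=
  \row_i (2 * N.+1%:R^-1 * (minn (p i) N.+1)%:R - 1).
have gQ p : Q _ (g p).
  apply: norm_le => // i; rewrite mxE ler_norml.
  rewrite -mulrA; set t := _^-1 * _.
  have t0 : 0 <= t by rewrite mulr_ge0 // invr_ge0 ltW.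
  have t1 : t <= 1 by rewrite /t mulrC ler_pdivrMr // mul1r ler_nat geq_minr.
  by apply/andP; split; lra.
have [|k p pk|k p pk|z zP] := @discrete_poincare_miranda d N.+1 (fun k p => 0 < H (g p) ord0 k).
- by [].
- rewrite -leNgt ltW // Hneg //; rewrite mxE pk min0n mulr0 sub0r //.
- by rewrite Hpos //; rewrite mxE pk minnn mulfVK ?gt_eqF //; lra.
pose p0 : {ffun 'I_d.+1 -> nat} := [ffun i => z i : nat].
exists (g p0); first exact: gQ.
have close (p : {ffun 'I_d.+1 -> nat}) : (forall m, z m <= p m <= (z m).+1)%N -> `|g p - g p0| <= 2 * N.+1%:R^-1.
  move=> pz; apply: norm_le => [|i]; first by rewrite mulr_ge0 // invr_ge0 ltW.
  rewrite !mxE ffunE opprB addrA subrK -mulrBr.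
  have zN := ltn_ord (z i); have /andP[zp pz'] := pz i.
  rewrite (minn_idPl (ltnW zN)) (minn_idPl (leq_trans pz' zN)).
  rewrite -natrB // normrM ger0_norm ?mulr_ge0 ?invr_ge0 ?(ltW N0) //.
  by rewrite ler_piMr ?mulr_ge0 ?invr_ge0 ?(ltW N0) // normr_nat lern1 leq_subLR addn1.
move=> k; have [x [y [xz yz]]] := zP k; rewrite -leNgt => Hx Hy.
by exists (g x), (g y); split=> //; split; exact: close.
Qed.

Lemma poincare_miranda d (H : 'rV[R]_d.+1 -> 'rV[R]_d.+1) :
  cont_on (Q _) H ->
  (forall x i, Q _ x -> x ord0 i = -1 -> H x ord0 i < 0) ->
  (forall x i, Q _ x -> x ord0 i = 1 -> 0 < H x ord0 i) ->
  exists2 x, Q _ x & H x = 0.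
Proof.
move=> Hc Hneg Hpos.
have /choice[u uP] N : exists u, Q _ u /\ forall k, exists x y : 'rV[R]_d.+1,
    [/\ Q _ x, Q _ y, `|x - u| <= 2 * N.+1%:R^-1 /\ `|y - u| <= 2 * N.+1%:R^-1,
        H x ord0 k <= 0 & 0 < H y ord0 k].
  by have [u uQ uP] := sign_change_cell N Hneg Hpos; exists u.
have [x xQ xu] := cube_cluster (fun N => (uP N).1).
(* If coordinate k of [H x] were nonzero, its sign would be constant near the cluster point [x], yet
   both signs occur in arbitrarily small cells close to [x]. *)
exists x => //; apply/rowP => k; rewrite [RHS]mxE; apply/eqP; apply: contraT => Hk.
have [de de0 Hde] := Hc x xQ `|H x ord0 k| (eq_ind_r (fun b : bool => b) Hk (normr_gt0 _)).
have de4 : 0 < de / 4 by rewrite divr_gt0.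
have [M HM] := cluster_small_index de4.
have [N MN uNx] := xu _ de4 M.
have [y [z [yQ zQ [yu zu] Hy Hz]]] := (uP N).2 k.
have near_x w : `|w - u N| <= 2 * N.+1%:R^-1 -> `|w - x| < de.
  move=> wu; apply: le_lt_trans (ler_distD (u N) w x) _.
  move: wu uNx (HM N MN); set a := `|_|; set b := `|_|; set t := _^-1; clearbody a b t; lra.
have := le_lt_trans (norm_coord _ k) (Hde y yQ (near_x y yu)).
have := le_lt_trans (norm_coord _ k) (Hde z zQ (near_x z zu)).
rewrite !mxE; have [Hx|Hx] := ltP 0 (H x ord0 k).
  by rewrite (gtr0_norm Hx) !ltr_norml => /andP[? ?] /andP[? ?]; lra.
by rewrite (ler0_norm Hx) !ltr_norml => /andP[? ?] /andP[? ?]; lra.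
Qed.

(** Uniform continuity of the inverse, by compactness: pairs violating it would cluster, and
    continuity of [g] at the image of the cluster point would bring both members close to that
    point. *)
Lemma inverse_modulus m n (D : set 'rV[R]_n) (f : 'rV[R]_m -> 'rV[R]_n)
    (g : 'rV[R]_n -> 'rV[R]_m) e :
  cont_on (Q m) f -> cont_on D g -> (forall u, Q m u -> D (f u)) ->
  (forall u, Q m u -> g (f u) = u) -> 0 < e ->
  exists2 de, 0 < de & forall u v, Q m u -> Q m v -> `|f u - f v| < de -> `|u - v| < e.
Proof.
move=> fc gc fD gf e0; apply: contrapT => Hno.
have /choice[uv uvP] N : exists uv : 'rV[R]_m * 'rV[R]_m,
    [/\ Q m uv.1, Q m uv.2, `|f uv.1 - f uv.2| < N.+1%:R^-1 & e <= `|uv.1 - uv.2|].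
  apply: contrapT => HN; apply: Hno; exists N.+1%:R^-1; first by rewrite invr_gt0 ltr0n.
  move=> u v uQ vQ fuv; rewrite ltNge; apply/negP => euv; apply: HN.
  by exists (u, v).
have uQ N : Q m (uv N).1 by have [] := uvP N.
have [x xQ xu] := cube_cluster uQ.
have e2 : 0 < e / 2 by rewrite divr_gt0.
have [d1 d10 Hg] := gc _ (fD x xQ) _ e2.
have d12 : 0 < d1 / 2 by rewrite divr_gt0.
have [d2 d20 Hf] := fc x xQ _ d12.
have [M HM] := cluster_small_index d12.
have [N MN uNx] := xu _ d20 M.
have [u1Q u2Q fN eN] := uvP N; set u := (uv N).1 in uNx u1Q fN eN; set v := (uv N).2 in u2Q fN eN.
have fu := Hf u u1Q uNx.
have fv : `|f v - f x| < d1.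
  apply: le_lt_trans (ler_distD (f u) (f v) (f x)) _; rewrite (distrC (f v)).
  move: fu fN (HM N MN); move: `|f u - f x| `|f u - f v| N.+1%:R^-1 => a b t.
  lra.
have fu' : `|f u - f x| < d1 by apply: lt_trans fu _; lra.
have := Hg _ (fD u u1Q) fu'; have := Hg _ (fD v u2Q) fv; rewrite (gf u) // (gf v) // (gf x) //.
move: eN (ler_distD x u v); rewrite (distrC x v).
move: `|u - v| `|u - x| `|v - x| => a b t. lra.
Qed.

(* The approximate inverse is the McShane-type infimum
   y |-> inf_u (u_i + L |y - f u|). *)
Lemma lipschitz_inverse m n (f : 'rV[R]_m -> 'rV[R]_n) e de :
  0 < e -> 0 < de ->
  (forall u v, Q m u -> Q m v -> `|f u - f v| < de -> `|u - v| < e) ->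
  exists (E : 'rV[R]_n -> 'rV[R]_m) (L : R),
    [/\ 0 < L, forall y z, `|E y - E z| <= L * `|y - z|
      & forall u, Q m u -> `|E (f u) - u| <= e].
Proof.
(* With this slope a point whose image is at distance at least [de] pays at least 2, the length of
   [-1, 1], and cannot lower the infimum at [f u] below u_i. *)
move=> e0 de0 Hf; pose L := 2 / de.
have L0 : 0 < L by rewrite divr_gt0.
pose S y i := [set u ord0 i + L * `|y - f u| | u in Q m].
have S0 y i : S y i !=set0.
  by exists ((0 : 'rV_m) ord0 i + L * `|y - f 0|); exists 0 => //=; rewrite normr0.
have Qc (u : 'rV[R]_m) i : Q m u -> -1 <= u ord0 i <= 1.
  by move=> uQ; rewrite -ler_norml (le_trans (norm_coord _ _)).
have Slb y i : has_lbound (S y i).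
  exists (-1) => _ [u uQ <-]; have /andP[h _] := Qc u i uQ.
  have : 0 <= L * `|y - f u| by rewrite mulr_ge0 // ltW.
  by move: (L * _) => t t0; rewrite (le_trans h) // lerDl.
have lip1 y z i : inf (S y i) <= inf (S z i) + L * `|y - z|.
  rewrite -lerBlDr; apply: lb_le_inf => // _ [u uQ <-]; rewrite lerBlDr.
  apply: (@le_trans _ _ (u ord0 i + L * `|y - f u|)).
    by apply: ge_inf => //; exists u.
  rewrite -addrA lerD2l -mulrDr ler_pM2l // [leRHS]addrC; exact: ler_distD.
exists (fun y => \row_i inf (S y i)), L; split=> // [y z|u uQ].
  apply: norm_le => [|i]; first by rewrite mulr_ge0 // ltW.
  rewrite !mxE ler_norml; have := lip1 y z i; have := lip1 z y i.
  by rewrite (distrC z y) => h1 h2; apply/andP; split; lra.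
apply: norm_le => [|i]; first exact: ltW.
rewrite !mxE ler_norml; apply/andP; split; last first.
  apply: (@le_trans _ _ 0); last exact: ltW.
  rewrite subr_le0; apply: ge_inf => //; exists u => //.
  by rewrite subrr normr0 mulr0 addr0.
rewrite lerBrDr addrC; apply: lb_le_inf => // _ [v vQ <-].
have [close|far] := ltP `|f u - f v| de.
  have : `|u ord0 i - v ord0 i| <= e.
    by have := Hf _ _ uQ vQ close; have := norm_coord (u - v) i; rewrite !mxE => h /ltW; exact: le_trans.
  have : 0 <= L * `|f u - f v| by rewrite mulr_ge0 // ltW.
  by rewrite ler_norml => h /andP[h1 h2]; lra.
have : 2 <= L * `|f u - f v|.
  by rewrite -[leLHS](@divfK _ de) ?gt_eqF // ler_pM2l.
have /andP[? ?] := Qc u i uQ; have /andP[? ?] := Qc v i vQ => ?; lra.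
Qed.

(* Pigeonhole: the sphere has about N^d cells of size 1/N, too few to reach a grid
   of N^(d+1) points of comparable spacing. *)
Lemma lipschitz_sphere_miss d (E : 'rV[R]_d.+1 -> 'rV[R]_d.+1) L c r e :
  0 < L -> 0 < r -> 0 < e ->
  (forall y z, `|E y - E z| <= L * `|y - z|) ->
  exists2 w, `|w| <= e & forall y, `|y - c| = r -> E y <> w.
Proof.
move=> L0 r0 e0 Elip; apply: contrapT => Hno.
have hit w : `|w| <= e -> exists y, `|y - c| = r /\ E y = w.
  move=> we; apply: contrapT => Hw; apply: Hno; exists w => // y yr Ey.
  by apply: Hw; exists y.
(* With N = C m, a cell of side 2r/N has image of diameter at most 2rL/(Cm) < e/m, the spacing of
   the m^(d+1) targets. There are 2(d+1)(N+1)^d codes, at most 2(d+1)(2C)^d m^d, and [m] is chosen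
   to make this less than m^(d+1). *)
pose C := (Num.truncn (2 * r * L / e)).+1.
have HC : 2 * r * L < C%:R * e.
  by rewrite -ltr_pdivrMr // truncnS_gt.
pose m := (2 * (d.+1 * (2 * C) ^ d)).+1.
have m0 : 0 < m%:R :> R by rewrite ltr0n.
pose N := (C * m)%N.
have N0 : 0 < N%:R :> R by rewrite ltr0n.
pose w (j : {ffun 'I_d.+1 -> 'I_m}) : 'rV[R]_d.+1 := \row_i (e * (j i)%:R / m%:R).
have wsep j j' : `|w j - w j'| < e / m%:R -> j = j'.
  move=> jj; apply/ffunP => i; apply/val_inj/eqP; apply: contraT => ne.
  have := le_lt_trans (norm_coord _ i) jj.
  rewrite !mxE -mulrBl -mulrBr !normrM normfV (ger0_norm (ltW m0)) (ger0_norm (ltW e0)).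
  rewrite ltr_pM2r ?invr_gt0 // gtr_pMr // ltNge => /negP[].
  rewrite -[X in X - _]/((j i : nat)%:Z%:~R) -[X in _ - X]/((j' i : nat)%:Z%:~R) -intrB.
  rewrite -intr_norm -[1]/(1%:~R) ler_int; move/eqP: ne => /=; lia.
have we j : `|w j| <= e.
  apply: norm_le => [|i]; first exact: ltW.
  rewrite mxE ger0_norm ?divr_ge0 ?mulr_ge0 ?(ltW e0) //.
  by rewrite ler_pdivrMr // ler_pM2l // ler_nat ltnW.
have /choice[y yP] j := hit _ (we j).
have /choice[ax axP] j : exists i, `|(y j - c) ord0 i| = r.
  have [yr _] := yP j; have [|i iE] := @norm_attained _ (y j - c); first by rewrite yr gt_eqF.
  by exists i; rewrite -iE.
pose pos j i := ((y j - c) ord0 i + r) / (2 * r) * N%:R.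
have pos_bd j i : 0 <= pos j i <= N%:R.
  have : `|(y j - c) ord0 i| <= r by have [<- _] := yP j; exact: norm_coord.
  rewrite ler_norml => /andP[h1 h2]; apply/andP; split.
    by rewrite mulr_ge0 // divr_ge0 ?mulr_ge0 ?(ltW r0) // -lerBlDr sub0r.
  by rewrite ler_piMl // ler_pdivrMr ?mulr_gt0 // mul1r; lra.
(* In the sup norm the sphere is the boundary of a cube: the code records a face, by axis and sign,
   and the cell in the other d coordinates. *)
pose code j : 'I_d.+1 * bool * {ffun 'I_d -> 'I_N.+1} :=
  (ax j, 0 < (y j - c) ord0 (ax j), [ffun l => inord (Num.truncn (pos j (lift (ax j) l)))]).
have code_inj : injective code.
  move=> j j' [axE sgE /ffunP posE]; apply: wsep.
  have [_ <-] := yP j; have [_ <-] := yP j'.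
  apply: le_lt_trans (Elip _ _) _.
  apply: (@le_lt_trans _ _ (L * (2 * r / N%:R))); last first.
    have C0 : 0 < C%:R :> R by rewrite ltr0n.
    have -> : L * (2 * r / N%:R) = 2 * r * L / C%:R / m%:R.
      by rewrite /N natrM; field; rewrite !gt_eqF.
    by rewrite ltr_pM2r ?invr_gt0 // ltr_pdivrMr // [e * _]mulrC.
  rewrite ler_pM2l //; apply: norm_le => [|i]; first by rewrite divr_ge0 ?mulr_ge0 ?ltW.
  have -> : (y j - y j') ord0 i = (y j - c) ord0 i - (y j' - c) ord0 i by rewrite !mxE; ring.
  have [->|] := eqVneq i (ax j).
    have := axP j; have := axP j'; rewrite -axE in sgE *.
    have : 0 <= 2 * r / N%:R by rewrite divr_ge0 ?mulr_ge0 ?ltW.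
    move: sgE; set p := (y j - c) _ _; set q := (y j' - c) _ _.
    case: (ltP 0 p) => p0 /esym; case: (ltP 0 q) => q0 // _ h.
      by rewrite (gtr0_norm p0) (gtr0_norm q0) => -> ->; rewrite subrr normr0.
    by rewrite (ler0_norm p0) (ler0_norm q0) => hq hp; (have -> : p = q by lra); rewrite subrr normr0.
  rewrite eq_sym; case: (unliftP (ax j) i) => [l ->|->]; last by rewrite eqxx.
  move=> _; have := posE l; rewrite !ffunE -axE => /(congr1 val).
  have le_N k i' : (Num.truncn (pos k i') < N.+1)%N.
    by have /andP[h1 h2] := pos_bd k i'; rewrite truncn_lt_nat // (le_lt_trans h2) // ltr_nat.
  rewrite /= !inordK // => tE.
  have /andP[hp _] := pos_bd j (lift (ax j) l); have /andP[hq _] := pos_bd j' (lift (ax j) l).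
  have := truncn_itv hp; have := truncn_itv hq; rewrite tE /pos.
  set p := (y j - c) _ _; set q := (y j' - c) _ _; set t := Num.truncn _.
  rewrite -natr1 => /andP[q1 q2] /andP[p1 p2].
  have pq : `|(p + r) / (2 * r) * N%:R - (q + r) / (2 * r) * N%:R| <= 1.
    move: q1 q2 p1 p2; move: (_ / _ * _) (_ / _ * _) => a b *.
    by rewrite ler_norml; apply/andP; split; lra.
  have E1 : p - q = ((p + r) / (2 * r) * N%:R - (q + r) / (2 * r) * N%:R) * (2 * r / N%:R).
    by field; rewrite !gt_eqF.
  by rewrite E1 normrM [X in _ * X]ger0_norm ?divr_ge0 ?mulr_ge0 ?(ltW r0) // ler_piMl ?divr_ge0 ?mulr_ge0 ?(ltW r0).
have := leq_card code code_inj.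
rewrite !card_prod !card_ffun !card_ord card_bool; apply/negP; rewrite -ltnNge.
have le1 : (N.+1 ^ d <= (2 * C) ^ d * m ^ d)%N.
  rewrite -expnMn; have [->|d0] := posnP d; first by rewrite !expn0.
  by rewrite leq_exp2r // -mulnA mul2n -addnn -addn1 leq_add2l muln_gt0.
rewrite expnS; apply: leq_ltn_trans (leq_mul (leqnn _) le1) _.
by rewrite mulnA ltn_pmul2r ?expn_gt0 // /m ltnS [(_ * 2)%N]mulnC mulnA.
Qed.

(** The maximum glues the radial projection onto the sphere of radius r about c with the identity
    outside it. *)
Lemma radial_push_cont m (c p : 'rV[R]_m) r : p != c ->
  {for p, continuous (fun y : 'rV[R]_m => c + (Num.max 1 (r / `|y - c|)) *: (y - c))}.
Proof.
move=> pc; have pc0 : `|p - c| != 0 by rewrite normr_eq0 subr_eq0.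
have sc : y - c @[y --> p] --> p - c by exact: (cvgB cvg_id (cvg_cst c)).
have hc : Num.max 1 (r / t) @[t --> `|p - c|] --> Num.max 1 (r / `|p - c|).
  have qc : r / t @[t --> `|p - c|] --> r / `|p - c|.
    by exact: (cvgM (cvg_cst r) (cvgV pc0 cvg_id)).
  rewrite maxr_absE; under eq_fun do rewrite maxr_absE.
  apply: cvgM (cvg_cst _); apply: cvgD.
    exact: (cvgD (cvg_cst (1 : R)) qc).
  exact: (cvg_norm (cvgB (cvg_cst (1 : R)) qc)).
have mc : Num.max 1 (r / `|y - c|) @[y --> p] --> Num.max 1 (r / `|p - c|).
  exact: (cvg_comp _ _ (cvg_norm sc) hc).
exact: (cvgD (cvg_cst c) (cvgZ mc sc)).
Qed.

(* Tao's argument: if c near f 0 were missed by f, then pushing f(Q) off c onto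
   spheres, following an approximate Lipschitz inverse, and translating by a small
   vector would give a map close to the identity without zeros. *)
Lemma invariance_of_domain d (D : set 'rV[R]_d.+1) (f g : 'rV[R]_d.+1 -> 'rV[R]_d.+1) :
  cont_on (Q _) f -> cont_on D g -> (forall u, Q _ u -> D (f u)) ->
  (forall u, Q _ u -> g (f u) = u) ->
  exists2 r, 0 < r & forall c, `|c - f 0| < r -> exists2 u, Q _ u & f u = c.
Proof.
move=> fc gc fD gf; have Q0 : Q d.+1 0 by rewrite /= normr0.
have [b b0 Hb] := inverse_modulus fc gc fD gf ltr01.
(* If |u| = 1 then |f u - f 0| is at least b, so f u stays at distance at least b/2 from any c
   within b/2 of f 0: the push does not move the image of the boundary of the cube. *)
pose r := b / 2; have r0 : 0 < r by rewrite divr_gt0.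
exists r => // c cr; apply: contrapT => Hc.
have missed u : Q _ u -> f u != c.
  by move=> uQ; apply/eqP => fu; apply: Hc; exists u.
have eta0 : 0 < r - `|c - f 0| by rewrite subr_gt0.
have [de de0 Hde] := fc 0 Q0 _ eta0.
have away u : Q _ u -> r <= `|f u - c| -> de <= `|u|.
  move=> uQ fu; rewrite leNgt; apply/negP => u_de.
  have := Hde u uQ; rewrite subr0 => /(_ u_de).
  have := ler_distD (f 0) (f u) c; rewrite (distrC (f 0) c).
  move: fu; move: `|f u - c| `|f u - f 0| `|c - f 0| => x y z; lra.
have edge u : Q _ u -> `|u| = 1 -> r <= `|f u - c|.
  move=> uQ u1; rewrite leNgt; apply/negP => fu.
  suff h : `|f u - f 0| < b by have := Hb u 0 uQ Q0 h; rewrite subr0 u1 ltxx.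
  apply: le_lt_trans (ler_distD c _ _) _; rewrite /r in fu cr.
  by move: fu cr; move: `|f u - c| `|c - f 0| => x y; lra.
(* Where the push is the identity, [H] is within 2e of the identity: 2e < 1 gives the signs on the
   faces of the cube, and 2e < de excludes zeros there, since such u have norm at least [de]. *)
pose e := Num.min de 1 / 4.
have e0 : 0 < e by rewrite divr_gt0 // lt_min de0 ltr01.
have [ede e1] : 4 * e <= de /\ 4 * e <= 1.
  by rewrite /e mulrC divfK // !ge_min !lexx orbT.
have [de' de'0 Hde'] := inverse_modulus fc gc fD gf e0.
have [E [L [L0 Elip Ef]]] := lipschitz_inverse e0 de'0 Hde'.
have [w we Ew] := lipschitz_sphere_miss c L0 r0 e0 Elip.
pose push (y : 'rV[R]_d.+1) := c + (Num.max 1 (r / `|y - c|)) *: (y - c).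
pose H u := E (push (f u)) - w.
have push_far y : y != c -> r <= `|y - c| -> push y = y.
  move=> yc ry; rewrite /push max_l ?scale1r ?subrKC // ler_pdivrMr ?mul1r //.
  by rewrite normr_gt0 subr_eq0.
have push_near y : y != c -> `|y - c| < r -> `|push y - c| = r.
  move=> yc ry; have yc0 : 0 < `|y - c| by rewrite normr_gt0 subr_eq0.
  have r1 : 1 <= r / `|y - c| by rewrite ler_pdivlMr // mul1r ltW.
  rewrite /push addrC addKr normrZ (max_r r1).
  rewrite ger0_norm; last by rewrite divr_ge0 ?(ltW r0).
  by rewrite -mulrA mulVf ?mulr1 ?gt_eqF.
have Hclose u : Q _ u -> r <= `|f u - c| -> `|H u - u| <= 2 * e.
  move=> uQ fu; rewrite /H push_far ?missed // addrAC.
  apply: le_trans (ler_normB _ _) _; rewrite mulr2n mulrDl mul1r lerD //; exact: Ef.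
have [|x i xQ xi|x i xQ xi|u uQ] := @poincare_miranda d H.
- move=> u uQ eps eps0; have eL : 0 < eps / L by rewrite divr_gt0.
  have := @cvgr_dist_lt _ _ _ _ _ _ _ (radial_push_cont (r := r) (missed u uQ)) _ eL.
  move=> h; have [s /= s0 Hs] := (nbhs_normP _ _).1 (h (nbhs_filter (f u))); have [t t0 Ht] := fc u uQ s s0.
  exists t => // v vQ vu; rewrite /H opprB addrA subrK.
  apply: le_lt_trans (Elip _ _) _; rewrite -ltr_pdivlMl // mulrC distrC; apply: Hs => /=.
  by rewrite distrC; apply: Ht.
- have x1 : `|x| = 1 by apply/eqP; rewrite eq_le xQ -(normrN1 R) -xi norm_coord.
  have := le_trans (norm_coord _ i) (Hclose x xQ (edge x xQ x1)).
  by rewrite !mxE xi ler_norml => /andP[]; lra.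
- have x1 : `|x| = 1 by apply/eqP; rewrite eq_le xQ -(normr1 R) -xi norm_coord.
  have := le_trans (norm_coord _ i) (Hclose x xQ (edge x xQ x1)).
  by rewrite !mxE xi ler_norml => /andP[]; lra.
(* Near c a zero would make [E] take the value [w] on the sphere, which [w] was chosen to avoid. *)
have [far Hu|near Hu] := leP r `|f u - c|.
  have := Hclose u uQ far; rewrite Hu sub0r normrN; have := away u uQ far; lra.
apply: (Ew (push (f u))); first by apply: push_near; rewrite ?missed.
by apply/eqP; rewrite -subr_eq0; apply/eqP.
Qed.

End RowVectors.

(** * Shellings without branching *)

Section Shellings.
Variable V : finType.
Implicit Types (s t r a b c F : {set V}) (K X Y S : {set {set V}}) (n k : nat).
Local Open Scope set_scope.

(** * Facets, ridges and shelling moves *)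

Lemma dim_eq s n : (Defs.dim s == n%:Z)%R = (#|s| == n.+1).
Proof. rewrite /Defs.dim; lia. Qed.

Lemma facetsP K s :
  reflect (s \in K /\ forall t, t \in K -> s \subset t -> t = s) (s \in facets K).
Proof. by rewrite inE; apply: maxsetP. Qed.

Lemma card_setD1 n F v : v \in F -> #|F| = n.+1 -> #|F :\ v| = n.
Proof. by move=> vF; rewrite (cardsD1 v) vF => -[]. Qed.

Lemma face_in_facet K s : s \in K -> exists2 F, F \in facets K & s \subset F.
Proof.
move=> sK; have [F Fmax sF] := maxset_exists (P := fun t => t \in K) sK.
by exists F => //; rewrite inE.
Qed.

Lemma pureP n K : pure_complex n K ->
  [/\ set0 \in K, forall s t, s \in K -> t \subset s -> t \in K
    & forall s, s \in facets K -> #|s| = n.+1].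
Proof.
case/andP => /andP[K0 /forallP Ks] /forallP Kf; split=> //.
- by move=> s t sK ts; have /implyP/(_ sK)/forallP/(_ t)/implyP/(_ ts) := Ks s.
- by move=> s sF; apply/eqP; rewrite -dim_eq; have /implyP/(_ sF) := Kf s.
Qed.

Lemma facetE n K s : pure_complex n K -> (s \in facets K) = (s \in K) && (#|s| == n.+1).
Proof.
move=> Kp; have [_ _ card] := pureP Kp; apply/idP/andP => [sF|[sK /eqP cs]].
  by rewrite card //; have [-> _] := facetsP _ _ sF.
have [F FF sF] := face_in_facet sK.
suff -> : s = F by [].
by apply/eqP; rewrite eqEcard sF cs (card _ FF) leqnn.
Qed.

Lemma in_facets_over K r s :
  (s \in facets_over K r) = (s \in facets K) && (r \subset s).
Proof. by rewrite in_set. Qed.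

Lemma ridge_in_facet n K s : pure_complex n K -> s \in K -> #|s| = n ->
  (0 < #|facets_over K s|)%N.
Proof.
move=> Kp sK cs; have [F FF sF] := face_in_facet sK.
by apply/card_gt0P; exists F; rewrite inE FF.
Qed.

Definition boundary_ridge n K r := (#|r| == n) && (#|facets_over K r| == 1)%N.

Lemma boundaryP n K s : pure_complex n K ->
  reflect (exists2 r, boundary_ridge n K r & s \subset r) (s \in boundary n K).
Proof.
move=> Kp; have [_ Ks _] := pureP Kp; rewrite inE.
have ridgeE r : (r \in ridges n K) = (r \in K) && (#|r| == n).
  by rewrite inE /Defs.dim; congr (_ && _); lia.
apply: (iffP existsP) => [[r /and3P[]]|[r /andP[rn r1] sr]].
  by rewrite ridgeE => /andP[_ rn] r1 sr; exists r; rewrite // /boundary_ridge rn.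
exists r; rewrite ridgeE rn r1 sr /= !andbT.
have /card_gt0P[F] : (0 < #|facets_over K r|)%N by rewrite (eqP r1).
by rewrite inE => /andP[/facetsP[FK _] rF]; apply: Ks rF.
Qed.

Definition no_branching n K := forall r, #|r| = n -> (#|facets_over K r| <= 2)%N.

(** The join of the simplex on a with the boundary of b consists of the subsets of a :|: b that do
    not contain b; this is the form in which the condition on [Y] is used below. *)
Lemma shelling_moveP n Y X a b : shelling_move n Y X a b ->
  [/\ pure_complex n Y, pure_complex n X, Y \subset X, [disjoint a & b]
    & [/\ b != set0, #|a :|: b| = n.+1, a \in Y,
       facets X = (a :|: b) |: facets Y
       & forall s, s \subset a :|: b -> (s \in Y) = ~~ (b \subset s)]].
Proof.
case/andP => /andP[/andP[/and3P[Yp Xp YX] /and4P[aX bX b0 ab]] /eqP Fdiff] /eqP Ymem.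
have sY s : s \subset a :|: b -> (s \in Y) = ~~ (b \subset s).
  move=> sF; have : (s \in [set s in Y | s \subset a :|: b]) = (s \in Y) by rewrite inE sF andbT.
  move=> <-; rewrite Ymem; apply/imset2P/idP => [[s1 t]|bs].
    rewrite !inE => s1a /properP[tb [x xb xt]] ->.
    apply/subsetPn; exists x => //; rewrite inE negb_or xt andbT.
    apply: contraL xb => /(subsetP s1a) xa.
    by rewrite (disjointFr ab xa).
  exists (s :&: a) (s :&: b); rewrite ?inE ?subsetIr //.
    by rewrite properE subsetIr subsetI negb_and bs.
  by rewrite -setIUr; apply/esym/setIidPl.
have FX : a :|: b \in facets X.
  have : a :|: b \in facets X :\: facets Y by rewrite Fdiff set11.
  by rewrite inE => /andP[].
split=> //; split=> //.
- by have [_ _] := pureP Xp; apply.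
- rewrite sY ?subsetUl //; apply: contra b0 => /setIidPl ba.
  by rewrite -ba setIC; move: ab; rewrite -setI_eq0.
- apply/setP => s; rewrite !in_setU1.
  have [->|sN] /= := eqVneq; first by [].
  apply/idP/idP => [sX|].
    by apply: contraNT sN => sY'; rewrite -in_set1 -Fdiff inE sY'.
  by rewrite !(facetE _ Yp) !(facetE _ Xp) => /andP[/(subsetP YX)-> ->].
Qed.

Lemma move_facets_over n Y X a b r : shelling_move n Y X a b -> #|r| = n ->
  [/\ r \subset a :|: b ->
        #|facets_over X r| = #|facets_over Y r|.+1,
      ~~ (r \subset a :|: b) -> facets_over X r = facets_over Y r
    & r \subset a :|: b -> b \subset r -> #|facets_over Y r| = 0%N].
Proof.
case/shelling_moveP => Yp Xp YX ab [b0 cF aY FX sY] rn.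
have [_ Ys _] := pureP Yp.
have FnY : a :|: b \notin facets Y.
  by rewrite (facetE _ Yp) sY // subsetUr.
split.
- move=> rF; have -> : facets_over X r = (a :|: b) |: facets_over Y r.
    by apply/setP => s; rewrite in_setU1 !in_facets_over FX in_setU1; case: eqP => [->|].
  by rewrite cardsU1 in_facets_over (negbTE FnY).
- move=> rF; apply/setP => s; rewrite !in_facets_over FX in_setU1.
  by case: eqP => [->|//]; rewrite (negbTE rF) !andbF.
- move=> rF br; apply/eqP; rewrite cards_eq0; apply/eqP/setP => s.
  rewrite in_facets_over in_set0; apply/negP => /andP[/facetsP[sY' _] rs].
  by have := Ys _ _ sY' rs; rewrite sY // br.
Qed.

Lemma move_no_branching n Y X a b :
  shelling_move n Y X a b -> no_branching n X -> no_branching n Y.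
Proof.
move=> mv nb r rn; have := nb r rn; have [h1 h2 _] := move_facets_over mv rn.
have [/h1 ->|/h2 -> //] := boolP (r \subset a :|: b); lia.
Qed.

(** A ridge of the new facet that contains b is new and has just this facet; one that does not was
    in [Y], already had a facet, and becomes interior. *)
Lemma move_boundary_ridge n Y X a b r :
  shelling_move n Y X a b -> no_branching n X ->
  boundary_ridge n X r =
    if r \subset a :|: b then (#|r| == n) && (b \subset r) else boundary_ridge n Y r.
Proof.
move=> mv nb; rewrite /boundary_ridge; have [rn|] /= := eqVneq; last by case: ifP.
have [h1 h2 h3] := move_facets_over mv rn; have /= := nb r rn.
have [rF|/h2 ->//] := boolP (r \subset a :|: b).
rewrite h1 // eqSS; have [br|br] := boolP (b \subset r); first by rewrite h3.
have [Yp _ _ _ [_ _ _ _ sY]] := shelling_moveP mv.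
have := ridge_in_facet Yp _ rn; rewrite sY // br => /(_ isT); lia.
Qed.

(** A ridge of the new facet that is in [Y] lies in some facet of [Y]; a second one would make three
    in [X]. *)
Lemma move_boundary_ridge_old n Y X a b r :
  shelling_move n Y X a b -> no_branching n X -> r \subset a :|: b ->
  boundary_ridge n Y r = (#|r| == n) && ~~ (b \subset r).
Proof.
move=> mv nb rF; rewrite /boundary_ridge; have [rn|//] /= := eqVneq.
have [h1 _ h3] := move_facets_over mv rn; have := nb r rn.
have [br|br] := boolP (b \subset r); first by rewrite h3.
have [Yp _ _ _ [_ _ _ _ sY]] := shelling_moveP mv.
have := ridge_in_facet Yp _ rn; rewrite sY // br => /(_ isT).
rewrite h1 //=; set x := #|_|; rewrite -/x; clearbody x; case: x => [|[|x]] //.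
Qed.

Lemma full_simplex_facets a : facets (full_simplex a) = [set a].
Proof.
apply/setP => s; rewrite in_set1; apply/facetsP/eqP => [[sa h]|->].
  by apply/esym/h; [rewrite inE|rewrite inE in sa].
split; first by rewrite inE.
by move=> t; rewrite inE => ta sa; apply/eqP; rewrite eqEsubset ta.
Qed.

Lemma full_simplex_pure n a : #|a| = n.+1 -> pure_complex n (full_simplex a).
Proof.
move=> ca; rewrite /pure_complex full_simplex_facets; apply/andP; split.
  rewrite /simplicial_complex inE sub0set /=; apply/forallP => s; apply/implyP.
  rewrite inE => sa; apply/forallP => t; apply/implyP => ts.
  by rewrite inE (subset_trans ts).
by apply/forallP => s; apply/implyP; rewrite in_set1 => /eqP ->; rewrite dim_eq ca.
Qed.

Lemma shelled_by_pure n (P : pred int) K : shelled_by n P K -> pure_complex n K.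
Proof.
case=> [a /eqP|Y X a b _ mv _]; first by rewrite dim_eq => /eqP /full_simplex_pure.
by have [] := shelling_moveP mv.
Qed.

Lemma shelled_by_sub n (P Q : pred int) K :
  subpred P Q -> shelled_by n P K -> shelled_by n Q K.
Proof.
move=> PQ; elim=> [a an|Y X a b _ IH mv /PQ Qb]; first exact: shelled_start.
exact: shelled_step IH mv Qb.
Qed.

Lemma shelled_connected n (P : pred int) K : shelled_by n P K ->
  {in facets K &, forall s t, connect (adjacent_facets n K) s t}.
Proof.
have sym X : connect_sym (adjacent_facets n X).
  apply: sym_connect_sym => s t; rewrite /adjacent_facets andbCA; congr (_ && (_ && _)).
  by apply/eq_existsb => r; rewrite [(r \subset s) && _]andbC.
elim=> [a _|Y X a b _ IH mv _].
  by rewrite full_simplex_facets => s t; rewrite !in_set1 => /eqP -> /eqP ->.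
have [Yp Xp YX ab [b0 cF aY FX sY]] := shelling_moveP mv.
have YsubX : subrel (connect (adjacent_facets n Y)) (connect (adjacent_facets n X)).
  apply: connect_sub => s t /and3P[sF tF /existsP[r /andP[rR rst]]].
  apply: connect1; rewrite /adjacent_facets FX !in_setU1 sF tF !orbT /=.
  apply/existsP; exists r; rewrite rst andbT; move: rR; rewrite !inE.
  by case/andP => /(subsetP YX) -> ->.
(* Removing a vertex of b leaves a ridge that does not contain b, hence a face of [Y], across which
   the new facet is attached. *)
have [v vb] : exists v, v \in b by apply/set0Pn.
have vF : v \in a :|: b by rewrite inE vb orbT.
have rY : (a :|: b) :\ v \in Y.
  by rewrite sY ?subsetDl //; apply/subsetPn; exists v => //; rewrite !inE eqxx.
have [G GF rG] := face_in_facet rY.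
have FG : connect (adjacent_facets n X) (a :|: b) G.
  apply: connect1; rewrite /adjacent_facets FX !in_setU1 eqxx GF orbT /=.
  apply/existsP; exists ((a :|: b) :\ v); rewrite rG subsetDl !andbT inE (subsetP YX) //=.
  by rewrite /Defs.dim (card_setD1 vF cF) eqxx.
have toG s : s \in facets X -> connect (adjacent_facets n X) s G.
  by rewrite FX in_setU1 => /orP[/eqP -> //|sF]; apply/YsubX/IH.
by move=> s t sX tX; apply: connect_trans (toG _ sX) _; rewrite sym toG.
Qed.

Lemma shelled_stacked d k K :
  (k <= d.+1)%N -> shelled_by d.+1 (fun i => (i < k%:Z)%R) K -> k_stacked d k K.
Proof.
move=> kd; elim=> [a /eqP|Y X a b _ IH mv bk].
  rewrite dim_eq => /eqP ca s; rewrite inE => sa sd.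
  have [v va vs] : exists2 v, v \in a & v \notin s.
    by apply/subsetPn/negP => as_; have := subset_leq_card as_; move: sd; rewrite /Defs.dim; lia.
  apply/(boundaryP _ (full_simplex_pure ca)); exists (a :\ v); last first.
    by rewrite subsetD1 sa.
  apply/andP; split; first by rewrite (card_setD1 va ca).
  rewrite (_ : facets_over _ _ = [set a]) ?cards1 //; apply/setP => t.
  by rewrite inE full_simplex_facets !in_set1; case: eqP => // ->; rewrite subsetDl.
have [Yp Xp YX ab [b0 cF aY FX sY]] := shelling_moveP mv.
move=> s sX sd; apply/(boundaryP _ Xp).
(* A face outside the new facet keeps its boundary ridge, which is not inside the new facet
   either. *)
have [sF|sF] := boolP (s \subset a :|: b); last first.
  have sYm : s \in Y.
    have [G] := face_in_facet sX; rewrite FX in_setU1 => /orP[/eqP ->|/facetsP[GY _] sG].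
      by rewrite (negbTE sF).
    by have [_ Ys _] := pureP Yp; apply: Ys sG.
  have /(boundaryP _ Yp)[r /andP[/eqP rn r1] sr] := IH s sYm sd.
  exists r => //; rewrite /boundary_ridge rn eqxx /=.
  have [_ -> //] := move_facets_over mv rn.
  by apply: contra sF; apply: subset_trans.
(* The sizes of b and s are at most k and d - k + 1, together less than d + 2, the size of the
   facet. *)
have [v vF vN] : exists2 v, v \in a :|: b & v \notin b :|: s.
  apply/subsetPn/negP => /subset_leq_card; rewrite cF.
  have : (#|b :|: s| <= #|b| + #|s|)%N by rewrite cardsU leq_subr.
  by move: sd bk; rewrite /Defs.dim; move: #|_| #|_| #|_| => x y z; lia.
have cr := card_setD1 vF cF.
exists ((a :|: b) :\ v).
  rewrite /boundary_ridge cr eqxx /=; have [h1 _ h3] := move_facets_over mv cr.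
  rewrite h1 ?h3 ?subsetDl // subsetD1 subsetUr.
  by move: vN; rewrite inE negb_or => /andP[].
by rewrite subsetD1 sF; move: vN; rewrite inE negb_or => /andP[].
Qed.

(** * Mod-2 cycles in links *)

Lemma ridgeP n F r : #|F| = n.+1 -> r \subset F -> #|r| = n ->
  exists2 x, x \in F & r = F :\ x.
Proof.
move=> cF rF cr; have [x xF xr] : exists2 x, x \in F & x \notin r.
  by apply/subsetPn/negP => /subset_leq_card; rewrite cF cr ltnn.
exists x => //; apply/eqP; rewrite eqEcard subsetD1 rF xr /=.
by rewrite (card_setD1 xF cF) cr.
Qed.

Lemma boundary_ridge_facet n K r :
  boundary_ridge n K r -> exists2 F, F \in facets K & r \subset F.
Proof.
case/andP => _ /eqP r1; have /card_gt0P[F] : (0 < #|facets_over K r|)%N by rewrite r1.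
by rewrite in_facets_over => /andP[]; exists F.
Qed.

(* The n-sets of S form a mod-2 cycle in the link of c. *)
Definition cycle_over n c S :=
  (forall r, r \in S -> #|r| = n /\ c \subset r) /\
  forall q : {set V}, #|q|.+1 = n -> c \subset q -> ~~ odd #|[set r in S | q \subset r]|.

(** By hypothesis the only members of S that can contain F minus v and v' are F :\ v and F :\ v', so
    parity forces both or neither. *)
Lemma cycle_pair n c S F v v' :
  cycle_over n c S -> #|F| = n.+1 -> v \in F -> v' \in F -> v != v' ->
  c \subset F :\ v -> c \subset F :\ v' ->
  (forall r, r \in S -> F :\ v :\ v' \subset r -> r \subset F) ->
  F :\ v \in S -> F :\ v' \in S.
Proof.
move=> [Sn Sc] cF vF v'F vv' cv cv' SF vS; apply: contraTT (isT) => v'S.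
have v'Fv : v' \in F :\ v by rewrite !inE eq_sym vv'.
have cFv := card_setD1 vF cF.
have cq : #|F :\ v :\ v'|.+1 = n by rewrite -cFv [in RHS](cardsD1 v') v'Fv.
have cq' : c \subset F :\ v :\ v'.
  by rewrite subsetD1 cv; move: cv'; rewrite subsetD1 => /andP[].
have := Sc _ cq cq'.
rewrite (_ : [set r in S | _] = [set F :\ v]) ?cards1 //.
apply/setP => r; rewrite !inE; apply/andP/eqP => [[rS qr]|->]; last by rewrite vS subsetDl.
have [x xF rE] := ridgeP cF (SF r rS qr) (Sn r rS).1.
have [<- //|xv] := eqVneq x v; move: v'S rS; rewrite rE.
have [-> /negP //|xv'] := eqVneq x v'.
have xq : x \in F :\ v :\ v' by rewrite !inE xv xv'.
by have := subsetP qr x xq; rewrite rE !inE eqxx.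
Qed.

(** A subset of F with two elements x, y missing lies in exactly two ridges of F, F :\ x and F :\
    y. *)
Lemma simplex_cycle n c F : #|F| = n.+1 -> c \subset F ->
  cycle_over n c [set r : {set V} | [&& #|r| == n, c \subset r & r \subset F]].
Proof.
move=> cF cF'; set T := [set r | _].
have TE r : (r \in T) = [&& #|r| == n, c \subset r & r \subset F] by rewrite inE.
split=> [r|q cq qc]; first by rewrite TE => /and3P[/eqP].
have [qF|qF] := boolP (q \subset F); last first.
  rewrite (_ : [set r in T | q \subset r] = set0) ?cards0 //.
  apply/setP => r; rewrite in_set0 in_set TE.
  by apply: contraNF qF => /andP[/and3P[_ _ rF] /subset_trans]; apply.
have /eqP/cards2P[x [y [xy Fq]]] : #|F :\: q| = 2%N.
  by rewrite cardsD (setIidPr qF) cF -cq -[in X in (X - _)%N]addn2 addKn.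
have : x \in F :\: q by rewrite Fq set21.
have : y \in F :\: q by rewrite Fq set22.
rewrite !in_setD => /andP[yq yF] /andP[xq xF].
rewrite (_ : [set r in T | q \subset r] = [set F :\ x; F :\ y]).
  rewrite cards2 (_ : _ != _) //; apply: contraNneq xy => /setP/(_ x).
  by rewrite !inE eqxx xF !andbT /= => /esym/negbT; rewrite negbK.
apply/setP => r; rewrite in_set2 in_set TE; apply/andP/orP => [[/and3P[/eqP rn cr rF] qr]|].
  have [z zF rE] := ridgeP cF rF rn.
  have : z \in F :\: q.
    by rewrite inE zF andbT; apply/negP => /(subsetP qr); rewrite rE !inE eqxx.
  by rewrite Fq !inE => /orP[/eqP <-|/eqP <-]; rewrite rE eqxx; [left|right].
have sub z : z \notin q -> q \subset F :\ z by rewrite subsetD1 qF.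
by case=> /eqP ->; rewrite sub ?(subset_trans qc) ?sub // subsetDl (card_setD1 _ cF) ?eqxx.
Qed.

Lemma odd_symdiff (T : finType) (A B : {set T}) :
  odd #|(A :\: B) :|: (B :\: A)| = odd #|A| (+) odd #|B|.
Proof.
rewrite -[in RHS](cardsID B A) -[in RHS](cardsID A B) [B :&: A]setIC !oddD.
rewrite cardsU (_ : _ :&: _ = set0) ?cards0 ?subn0 ?oddD; last first.
  by apply/setP => x; rewrite !inE; case: (x \in A); rewrite ?andbF.
by rewrite addbACA addbb.
Qed.

Lemma cycle_symdiff n c S T : cycle_over n c S -> cycle_over n c T ->
  cycle_over n c ((S :\: T) :|: (T :\: S)).
Proof.
move=> [Sn Sc] [Tn Tc]; split=> [r|q cq qc].
  by rewrite !inE => /orP[/andP[_ /Sn]|/andP[_ /Tn]].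
rewrite (_ : [set r in (S :\: T) :|: (T :\: S) | q \subset r] = ([set r in S | q \subset r] :\: [set r in T | q \subset r])
  :|: ([set r in T | q \subset r] :\: [set r in S | q \subset r])).
  by rewrite odd_symdiff (negbTE (Sc q cq qc)) (negbTE (Tc q cq qc)).
apply/setP => r; rewrite !inE.
by case: (r \in S); case: (r \in T); case: (q \subset r).
Qed.

(* In the link of any face, the boundary of a shelled complex without branching
   carries no mod-2 cycle besides 0 and itself. *)
Lemma shelled_boundary_cycle n (P : pred int) K : shelled_by n P K ->
  no_branching n K -> forall c S, cycle_over n c S ->
  (forall r, r \in S -> boundary_ridge n K r) -> S != set0 ->
  forall r, boundary_ridge n K r -> c \subset r -> r \in S.
Proof.
elim=> [a /eqP an|Y X a b _ IH mv _] nb c S Sc Sb /set0Pn[r0 r0S] r rb cr.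
  move: an; rewrite dim_eq => /eqP ca.
  have sub s : boundary_ridge n (full_simplex a) s -> exists2 x, x \in a & s = a :\ x.
    move=> sb; have [F] := boundary_ridge_facet sb.
    rewrite full_simplex_facets in_set1 => /eqP -> sa; apply: ridgeP ca sa _.
    by case/andP: sb => /eqP.
  have [x xa r0E] := sub _ (Sb _ r0S); have [y ya rE] := sub _ rb.
  have [_ cr0] := Sc.1 _ r0S.
  rewrite rE; have [<-|xy] := eqVneq x y; first by rewrite -r0E.
  apply: (cycle_pair Sc ca xa) => //; rewrite -?r0E -?rE //.
  by move=> s /Sb/sub[z _ -> _]; rewrite subsetDl.
have [Yp Xp YX ab [b0 cF aY FX sY]] := shelling_moveP mv.
have [_ Ys _] := pureP Yp.
have nbY := move_no_branching mv nb.
have face_old s : boundary_ridge n Y s -> s \in Y.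
  by case/boundary_ridge_facet => F /facetsP[FY _]; apply: Ys.
have no_b s t : boundary_ridge n Y s -> t \subset s -> t \subset a :|: b -> ~~ (b \subset t).
  by move=> /face_old sYm ts tF; rewrite -sY //; apply: Ys ts.
set F := a :|: b in cF FX sY no_b *.
have bdX s : boundary_ridge n X s =
    if s \subset F then (#|s| == n) && (b \subset s) else boundary_ridge n Y s.
  exact: move_boundary_ridge mv nb.
have bdY s : s \subset F -> boundary_ridge n Y s = (#|s| == n) && ~~ (b \subset s).
  exact: move_boundary_ridge_old mv nb.
have bF v : v \in b -> v \in F by rewrite inE orbC => ->.
have bd_b v : v \in b -> v \notin c -> c \subset F ->
    boundary_ridge n Y (F :\ v) /\ c \subset F :\ v.
  move=> vb vc cF'; rewrite bdY ?subsetDl // (card_setD1 (bF v vb) cF) eqxx /=.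
  by rewrite !subsetD1 vb andbF cF' vc.
have [/existsP[x /andP[xS xF]]|] := boolP [exists s, (s \in S) && (s \subset F)]; last first.
  (* S avoids the new facet F, so it is a cycle in the boundary of [Y] and by induction is all of it
     over c. If c were inside F, that would include F :\ v for some v in b outside c, a ridge of
     F. *)
  rewrite negb_exists => /forallP SF.
  have SbY s : s \in S -> boundary_ridge n Y s.
    by move=> sS; have := Sb s sS; rewrite bdX; have := SF s; rewrite sS /= => /negbTE ->.
  have all_S := IH nbY c S Sc SbY (introT (set0Pn S) (ex_intro _ r0 r0S)).
  move: rb; rewrite bdX; case: ifP => [rF _|_ rbY]; last exact: all_S.
  have cF' := subset_trans cr rF.
  have := no_b _ _ (SbY _ r0S) (Sc.1 _ r0S).2 cF'.
  case/subsetPn => v vb vc; have [vbY vcs] := bd_b v vb vc cF'.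
  by have := SF (F :\ v); rewrite (all_S _ vbY vcs) subsetDl.
have [xn cx] := Sc.1 _ xS.
have cF' := subset_trans cx xF.
have [v vF xE] := ridgeP cF xF xn.
have : boundary_ridge n X x by exact: Sb.
rewrite bdX xF xn eqxx /= xE subsetD1 => /andP[_ vb].
(* F minus v and w still contains b, so it is not a face of [Y], and only ridges of F lie over it:
   parity spreads from F :\ v to the other new boundary ridges. *)
have all_a w : w \in F -> w \notin b -> w \notin c -> F :\ w \in S.
  move=> wF wb wc; have [<-|vw] := eqVneq v w; first by rewrite -xE.
  have cw : c \subset F :\ w by rewrite subsetD1 cF'.
  apply: (cycle_pair Sc cF vF wF) => //; rewrite -?xE //.
  move=> s /Sb; rewrite bdX; case: ifP => // _ sbY qs.
  have qF : x :\ w \subset F by exact: subset_trans (subsetDl _ _) xF.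
  have := no_b _ _ sbY qs qF; rewrite xE !subsetD1 vb wb.
  by rewrite /F subsetUr.
(* Adding the boundary of F over c mod 2 trades the ridges of F containing b for those that do not,
   giving a cycle in the boundary of [Y]. *)
pose T := [set s : {set V} | [&& #|s| == n, c \subset s & s \subset F]].
have Tc : cycle_over n c T by exact: simplex_cycle.
have SbY s : s \in (S :\: T) :|: (T :\: S) -> boundary_ridge n Y s.
  rewrite !inE => /orP[/andP[sT sS]|/andP[sS /and3P[/eqP sn cs sF]]].
    have [sn cs] := Sc.1 _ sS; have := Sb _ sS; rewrite bdX.
    by move: sT; rewrite sn cs eqxx /= => sF; rewrite (negbTE sF).
  rewrite bdY // sn eqxx /=; have [w wF sE] := ridgeP cF sF sn.
  apply: contraNN sS; rewrite sE subsetD1 => /andP[_ wb]; apply: all_a => //.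
  by move: cs; rewrite sE subsetD1 => /andP[].
(* If S = T, a boundary ridge over c outside F would make c a face of [Y], so some w in b is not in
   c; then F :\ w is in T but is not a boundary ridge of [X]. *)
have [ST|ST] := eqVneq ((S :\: T) :|: (T :\: S)) set0.
  have {}ST s : (s \in S) = (s \in T).
    by move/setP/(_ s): ST; rewrite in_setU !in_setD in_set0; case: (s \in S); case: (s \in T).
  rewrite ST inE cr; move: rb; rewrite bdX; case: ifP => [_ /andP[->]//|_ rbY].
  have /subsetPn[w wb wc] := no_b _ _ rbY cr cF'.
  have [_ cw] := bd_b w wb wc cF'.
  have : F :\ w \in S by rewrite ST inE (card_setD1 (bF w wb) cF) eqxx cw subsetDl.
  by move/Sb; rewrite bdX subsetDl subsetD1 wb /= !andbF.
have all_S := IH nbY c _ (cycle_symdiff Sc Tc) SbY ST.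
move: rb; rewrite bdX; case: ifP => [rF /andP[/eqP rn br]|rF rbY].
  have [w wF rE] := ridgeP cF rF rn; rewrite rE; apply: all_a => //.
    by move: br; rewrite rE subsetD1 => /andP[].
  by move: cr; rewrite rE subsetD1 => /andP[].
by have := all_S r rbY cr; rewrite in_setU !in_setD ![_ \in T]in_set rF !andbF /= orbF.
Qed.

(** For n = d + 1 the bound on c says that its dimension is at most d - k, so that c violates
    k-stackedness. *)
Lemma shelled_small_or_interior n k (P : pred int) K : shelled_by n P K ->
  no_branching n K ->
  shelled_by n (fun i => (i < k%:Z)%R) K \/
  exists c, [/\ c \in K, (#|c| + k <= n)%N & forall r, boundary_ridge n K r -> ~~ (c \subset r)].
Proof.
elim=> [a an|Y X a b sh IH mv _] nb; first by left; exact: shelled_start.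
have [Yp Xp YX ab [b0 cF aY FX sY]] := shelling_moveP mv.
have nbY := move_no_branching mv nb.
have bdX s : boundary_ridge n X s = _ := move_boundary_ridge s mv nb.
have bdY s sF : boundary_ridge n Y s = _ := @move_boundary_ridge_old _ _ _ _ _ s mv nb sF.
have bF v : v \in b -> v \in a :|: b by rewrite inE orbC => ->.
have [small|[c [cY ck cint]]] := IH nbY; last first.
  right; exists c; split=> //; first exact: (subsetP YX).
  (* An interior c stays interior: if it were inside the new facet, then, as a face of [Y], it would
     miss some v in b, and the facet minus v would be a boundary ridge of [Y] over c. *)
  move=> r; rewrite bdX; case: ifP => [rF _|_ /cint//]; apply/negP => cr.
  have cF' := subset_trans cr rF.
  move: cY; rewrite sY // => /subsetPn[v vb vc].
  have := cint ((a :|: b) :\ v); rewrite bdY ?subsetDl // (card_setD1 (bF v vb) cF) eqxx.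
  by rewrite !subsetD1 vb andbF cF' vc => /(_ isT).
have [bk|bk] := ltnP #|b| k.+1.
  by left; apply: shelled_step small mv _; rewrite /Defs.dim; move: bk; move: #|_| => x; lia.
right; exists a; split; first exact: (subsetP YX).
  move: cF; rewrite cardsU (_ : a :&: b = set0) ?cards0 ?subn0.
    by move: bk; move: #|_| #|_| => x y; lia.
  by apply/eqP; rewrite setI_eq0.
(* These ridges are the facet minus a vertex of b. They form a cycle over a in the boundary of [Y],
   hence are all its boundary ridges over a, and the move makes every one of them interior. *)
pose T := [set s : {set V} | [&& #|s| == n, a \subset s & s \subset a :|: b]].
have TY r : r \in T -> boundary_ridge n Y r.
  rewrite inE => /and3P[rn ar rF]; rewrite bdY // rn /=; apply/negP => br.
  have : a :|: b \subset r by rewrite subUset ar.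
  by move/subset_leq_card; rewrite cF (eqP rn) ltnn.
have T0 : T != set0.
  have [v vb] : exists v, v \in b by apply/set0Pn.
  apply/set0Pn; exists ((a :|: b) :\ v).
  by rewrite inE (card_setD1 (bF v vb) cF) eqxx subsetDl subsetD1 subsetUl (disjointFl ab vb).
move=> r; rewrite bdX; case: ifP => [rF /andP[rn br]|rF rbY]; apply/negP => ar.
  have : a :|: b \subset r by rewrite subUset ar.
  by move/subset_leq_card; rewrite cF (eqP rn) ltnn.
have := shelled_boundary_cycle sh nbY (simplex_cycle cF (subsetUl a b)) TY T0 rbY ar.
by rewrite inE rF !andbF.
Qed.

(** The second hypothesis is conditional because the purity used to exclude branching is read off
    the shelling, not off the geometry. *)
Lemma k_shelledP d k K : (k <= d.+1)%N -> (shellable d.+1 K -> no_branching d.+1 K) ->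
  k_shelled d.+1 k K <-> shellable d.+1 K /\ k_stacked d k K.
Proof.
move=> kd nbK; split=> [[_ sh]|[sh st]].
  by split; [apply: shelled_by_sub sh|exact: shelled_stacked sh].
have nb := nbK sh; have Kp := shelled_by_pure sh; split.
  apply/and3P; split=> //; last first.
    apply/forallP => s; apply/implyP => sF; apply/forallP => t; apply/implyP => tF.
    exact: shelled_connected sh _ _ sF tF.
  apply/forallP => r; apply/implyP; rewrite inE /Defs.dim => /andP[_ rn].
  by apply: nb; move: rn; move: #|_| => x; lia.
have [//|[c [cK ck cint]]] := shelled_small_or_interior k sh nb.
have /(boundaryP _ Kp)[r rb cr] : c \in boundary d.+1 K.
  by apply: st => //; rewrite /Defs.dim; move: ck; move: #|_| => x; lia.
by have := cint r rb; rewrite cr.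
Qed.

End Shellings.

(** * Ridges of triangulated balls *)

Section Book.
Local Open Scope classical_set_scope.
Local Open Scope ring_scope.
Variables (R : realType) (V : finType) (d : nat).
Local Notation n := d.+1.
Local Notation point := 'rV[R]_#|V|.
Local Notation Q := [set x : 'rV[R]_n | `|x| <= 1].

Definition weights (p : V -> R) : point := \row_i p (enum_val i).

Lemma weightsE p v : weights p ord0 (enum_rank v) = p v.
Proof. by rewrite mxE enum_rankK. Qed.

Lemma weights_carrier (K : {set {set V}}) (p : V -> R) (F : {set V}) :
  (forall s t : {set V}, s \in K -> t \subset s -> t \in K) -> F \in K ->
  (forall v, 0 <= p v) -> \sum_v p v = 1 -> (forall v, v \notin F -> p v = 0) ->
  carrier K (weights p).
Proof.
move=> Ks FK p0 p1 pF; split=> [i|]; first by rewrite mxE.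
split.
  rewrite -[RHS]p1 [RHS](reindex (@enum_val V V)) /=.
    by apply: eq_bigr => i _; rewrite mxE.
  by apply: onW_bij; exact: enum_val_bij.
apply: Ks FK _; apply/fintype.subsetP => v; rewrite inE weightsE.
by apply: contraNT => /pF ->.
Qed.

(* The two pages v1, v2 of the book with spine r = range e, parametrized by the
   cube so that the origin is the barycenter of r: u_0 > 0 lies in page v1, u_0 < 0
   in page v2, and u_i is the displacement along e i. *)
Variables (v1 v2 v3 : V) (e : 'I_n -> V) (r : {set V}).
Hypotheses (e_inj : injective e) (e_r : forall v, (v \in r) = [exists i, e i == v]).
Hypotheses (v1r : v1 \notin r) (v2r : v2 \notin r) (v3r : v3 \notin r).
Hypotheses (v12 : v1 != v2) (v13 : v1 != v3) (v23 : v2 != v3).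

(* Large enough for the weights below to be nonnegative on the cube. *)
Let M : R := n%:R ^+ 2.

Lemma e_in_r i : e i \in r.
Proof. by rewrite e_r; apply/existsP; exists i. Qed.

(** The vertex [e ord0] pays for the weight |u_0|/M of the page vertices and for the other
    displacements, which keeps the total at 1. *)
Definition spine_part (u : 'rV[R]_n) (i : 'I_n) : R :=
  n%:R^-1 + (if i == ord0 then - (`|u ord0 ord0| + \sum_(j | j != ord0) u ord0 j)
             else u ord0 i) / M.

Definition page_weight (u : 'rV[R]_n) (v : V) : R :=
  (if v == v1 then Num.max (u ord0 ord0) 0 / M else 0) +
  (if v == v2 then Num.max (- u ord0 ord0) 0 / M else 0) +
  \sum_(i | e i == v) spine_part u i.

Lemma M_gt0 : 0 < M.
Proof. by rewrite exprn_gt0 // ltr0n. Qed.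

Lemma sum_page a (w : V) : \sum_v (if v == w then a else 0) = a :> R.
Proof. by rewrite (bigD1 w) //= eqxx big1 ?addr0 // => v /negbTE ->. Qed.

Lemma page_weight_sum u : \sum_v page_weight u v = 1.
Proof.
rewrite !big_split /= !sum_page (exchange_big_dep predT) //=.
rewrite (eq_bigr (spine_part u)); last first.
  by move=> i _; rewrite (big_pred1 (e i)) // => v /=; rewrite eq_sym.
rewrite big_split /= sumr_const card_ord -[_ *+ _]mulr_natl mulfV ?pnatr_eq0 //.
rewrite -mulr_suml (bigD1 ord0) //= .
set S := \sum_(j | j != ord0) u ord0 j.
rewrite [\sum_(i | _) (if _ then _ else _)](_ : _ = S); last first.
  by apply: eq_bigr => j /negbTE ->.
have := M_gt0; case: (leP 0 (u ord0 ord0)) => u0 M0.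
  rewrite max_r ?oppr_le0 // ger0_norm //; field; exact: lt0r_neq0.
rewrite max_l ?oppr_ge0 ?ltW // ltr0_norm //; field; exact: lt0r_neq0.
Qed.

(** The displacement before scaling is at most 1 + (n - 1) = n, and n / M = 1/n. *)
Lemma spine_part_ge0 u i : Q u -> 0 <= spine_part u i.
Proof.
move=> uQ; have uj j : `|u ord0 j| <= 1 by apply: le_trans (norm_coord _ j) uQ.
have n0 : 0 < n%:R :> R by rewrite ltr0n.
rewrite /spine_part -(@pmulr_rge0 _ M) ?M_gt0 // mulrDr [M * (_ / M)]mulrC.
rewrite divfK ?(lt0r_neq0 M_gt0) // /M expr2 mulfK ?(lt0r_neq0 n0) // -lerBlDr sub0r; case: ifP => _.
  rewrite opprK; have -> : n%:R = 1 + \sum_(j < n | j != ord0) 1 :> R.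
    have := sumr_const (pred_of_simpl (@predT 'I_n)) (1 : R).
    by rewrite (bigD1 ord0) //= card_ord.
  apply: lerD; first exact: uj.
  by apply: ler_sum => j _; have := uj j; rewrite ler_norml => /andP[].
have := uj i; rewrite ler_norml => /andP[h _].
by apply: (@le_trans _ _ 1); rewrite ?ler1n // lerNl.
Qed.

Lemma page_weight_ge0 u v : Q u -> 0 <= page_weight u v.
Proof.
move=> uQ; rewrite !addr_ge0 //.
- by case: ifP => // _; rewrite divr_ge0 ?le_max ?lexx ?orbT // ltW // M_gt0.
- by case: ifP => // _; rewrite divr_ge0 ?le_max ?lexx ?orbT // ltW // M_gt0.
by apply: sumr_ge0 => i _; exact: spine_part_ge0.
Qed.

Lemma page_weight_spine u i : page_weight u (e i) = spine_part u i.
Proof.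
have er := e_in_r i.
have neq v : v \notin r -> (e i == v) = false by move=> vr; apply: contraNF vr => /eqP <-.
rewrite /page_weight !neq //.
by rewrite !add0r (big_pred1 i) // => j; rewrite /= (inj_eq e_inj).
Qed.

Lemma page_weight_out u v : v \notin r -> v != v1 -> v != v2 -> page_weight u v = 0.
Proof.
move=> vr /negbTE h1 /negbTE h2; rewrite /page_weight h1 h2 !add0r big_pred0 // => i.
by apply: contraNF vr => /eqP <-; exact: e_in_r.
Qed.

Lemma page_weight_page u :
  page_weight u v1 = Num.max (u ord0 ord0) 0 / M /\
  page_weight u v2 = Num.max (- u ord0 ord0) 0 / M.
Proof.
have no v : v \notin r -> forall i, (e i == v) = false.
  by move=> vr i; apply: contraNF vr => /eqP <-; exact: e_in_r.
rewrite /page_weight !eqxx [v2 == v1]eq_sym (negbTE v12) !big_pred0 ?addr0 ?add0r //.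
  exact: no. exact: no.
Qed.

(** A left inverse of [page] on the whole space; coordinate 0 comes back as max(t, 0) - max(-t, 0) =
    t. *)
Definition page_coord (x : point) : 'rV[R]_n :=
  \row_i (if i == ord0 then M * (x ord0 (enum_rank v1) - x ord0 (enum_rank v2))
          else M * (x ord0 (enum_rank (e i)) - n%:R^-1)).

Definition page (u : 'rV[R]_n) : point := weights (page_weight u).

Lemma page_coordK u : page_coord (page u) = u.
Proof.
have M0 : M != 0 by rewrite gt_eqF // M_gt0.
apply/rowP => i; rewrite mxE !weightsE; have [->|i0] := eqVneq i ord0.
  have [-> ->] := page_weight_page u; rewrite -mulrBl mulrC divfK //.
  by case: (leP 0 (u ord0 ord0)) => u0;
    [rewrite max_r ?oppr_le0 // subr0|rewrite max_l ?oppr_ge0 ?ltW // sub0r opprK].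
by rewrite page_weight_spine /spine_part (negbTE i0) [_ + _ / _]addrC addrK mulrC divfK.
Qed.

Lemma page_coord_cont A : cont_on A page_coord.
Proof.
move=> x _ eps eps0; have M0 := M_gt0.
exists (eps / (2 * M) / 2); first by rewrite !divr_gt0 // mulr_gt0.
move=> y _ yx; apply: le_lt_trans (_ : eps / 2 < eps); last by lra.
have co k : `|y ord0 k - x ord0 k| <= eps / (2 * M) / 2.
  by have := norm_coord (y - x) k; rewrite !mxE => h; apply: le_trans h (ltW yx).
have epsE : eps / 2 = M * (eps / (2 * M) / 2 + eps / (2 * M) / 2).
  by field; rewrite gt_eqF.
apply: norm_le => [|i]; first by rewrite divr_ge0 // ltW.
rewrite !mxE epsE; case: ifP => _; rewrite -mulrBr normrM gtr0_norm // ler_pM2l //.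
  have := co (enum_rank v1); have := co (enum_rank v2); rewrite !ler_norml.
  move: (eps / _ / _) => t /andP[? ?] /andP[? ?]; apply/andP; split; lra.
have := co (enum_rank (e i)); have : 0 <= eps / (2 * M) / 2 by rewrite !divr_ge0 ?mulr_ge0 ?ltW.
rewrite !ler_norml; move: (eps / _ / _) (n%:R^-1 : R) => t s t0 /andP[? ?].
by apply/andP; split; lra.
Qed.

Lemma page_carrier (K : {set {set V}}) u :
  (forall s t : {set V}, s \in K -> t \subset s -> t \in K) -> v1 |: r \in K -> v2 |: r \in K ->
  Q u -> carrier K (page u).
Proof.
move=> Ks F1 F2 uQ; have w1 := page_weight_sum u.
have w0 v := page_weight_ge0 v uQ.
have [h1 h2] := page_weight_page u.
have [u0|u0] := leP 0 (u ord0 ord0).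
  apply: weights_carrier Ks F1 w0 w1 _ => v; rewrite !inE negb_or => /andP[vv1 vr].
  have [->|vv2] := eqVneq v v2; last exact: page_weight_out.
  by rewrite h2 max_r ?oppr_le0 // mul0r.
apply: weights_carrier Ks F2 w0 w1 _ => v; rewrite !inE negb_or => /andP[vv2 vr].
have [->|vv1] := eqVneq v v1; last exact: page_weight_out.
by rewrite h1 max_r ?ltW // mul0r.
Qed.

Lemma spine_part_lip u w i : `|spine_part u i - spine_part w i| <= `|u - w|.
Proof.
have uw j : `|u ord0 j - w ord0 j| <= `|u - w|.
  by have := norm_coord (u - w) j; rewrite !mxE.
have n1 : 1 <= n%:R :> R by rewrite ler1n.
have dE (a b c : R) : c + a / M - (c + b / M) = (a - b) / M.
  by rewrite opprD addrACA subrr add0r mulrBl.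
rewrite dE normrM normfV (gtr0_norm M_gt0).
rewrite ler_pdivrMr ?M_gt0 //; apply: (@le_trans _ _ (`|u - w| * n%:R)); last first.
  by rewrite ler_wpM2l // /M expr2 ler_peMl // (le_trans ler01).
case: ifP => _; last by rewrite (le_trans (uw i)) // ler_peMr.
rewrite -opprD normrN opprD addrACA -sumrB.
apply: le_trans (ler_normD _ _) _.
have -> : `|u - w| * n%:R = `|u - w| + \sum_(j < n | j != ord0) `|u - w|.
  have := sumr_const (pred_of_simpl (@predT 'I_n)) `|u - w|.
  by rewrite (bigD1 ord0) //= card_ord mulr_natr.
apply: lerD; first exact: le_trans (ler_dist_dist _ _) (uw ord0).
by apply: le_trans (ler_norm_sum _ _ _) _; apply: ler_sum => j _.
Qed.

(** One 1-Lipschitz term for each of the n spine vertices and the two page vertices. *)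
Lemma page_weight_lip u w v :
  `|page_weight u v - page_weight w v| <= (n%:R + 2) * `|u - w|.
Proof.
have uw : `|u ord0 ord0 - w ord0 ord0| <= `|u - w|.
  by have := norm_coord (u - w) ord0; rewrite !mxE.
have M1 : 1 <= M by rewrite exprn_ege1 // ler1n.
have maxlip (a b : R) : `|a - b| <= `|u - w| ->
    `|Num.max a 0 / M - Num.max b 0 / M| <= `|u - w|.
  move=> ab; rewrite -mulrBl normrM normfV (gtr0_norm M_gt0) ler_pdivrMr ?M_gt0 //.
  apply: (@le_trans _ _ `|u - w|); last by rewrite ler_peMr.
  move: ab; rewrite !ler_norml => /andP[h1 h2].
  by case: (leP a 0) => ?; case: (leP b 0) => ?; apply/andP; split; lra.
rewrite /page_weight opprD addrACA (mulrC _ `|u - w|) mulrDr mulr_natr (addrC (`|u - w| *+ n)).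
apply: le_trans (ler_normD _ _) _; apply: lerD.
  rewrite opprD addrACA mulr_natr mulr2n; apply: le_trans (ler_normD _ _) _; apply: lerD.
    by case: ifP => _; rewrite ?subrr ?normr0 //; exact: maxlip.
  case: ifP => _; rewrite ?subrr ?normr0 //; apply: maxlip.
  by rewrite -opprD normrN.
rewrite -sumrB; apply: le_trans (ler_norm_sum _ _ _) _.
apply: (@le_trans _ _ (\sum_(i < n) `|u - w|)); last by rewrite sumr_const card_ord.
rewrite big_mkcond; apply: ler_sum => i _; case: ifP => _ //; exact: spine_part_lip.
Qed.

Lemma page_cont A : cont_on A page.
Proof.
move=> x _ eps eps0; have n2 : 0 < n%:R + 2 :> R by rewrite addr_gt0 // ltr0n.
exists (eps / (n%:R + 2) / 2); first by rewrite !divr_gt0.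
move=> y _ yx; apply: le_lt_trans (_ : eps / 2 < eps); last by lra.
apply: norm_le => [|k]; first by rewrite divr_ge0 // ltW.
rewrite !mxE; apply: le_trans (page_weight_lip y x _) _.
by rewrite -ler_pdivlMl // [leRHS]mulrC mulrAC ltW.
Qed.

(** A path into page v3 from the barycenter of r, moving weight t from [e ord0] to v3. *)
Definition third_page (t : R) : point :=
  weights (fun v => page_weight 0 v + (if v == v3 then t else 0) - (if v == e ord0 then t else 0)).

Lemma page_weight0 v : page_weight 0 v = if v \in r then n%:R^-1 else 0.
Proof.
have s0 i : spine_part 0 i = n%:R^-1.
  by rewrite /spine_part !mxE normr0 big1 ?addr0 ?oppr0 ?if_same ?mul0r ?addr0 // => j _; rewrite mxE.
case: ifPn => [|vr]; first by rewrite e_r => /existsP[i /eqP <-]; rewrite page_weight_spine.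
have [h1 h2] := page_weight_page 0.
have [->|vv1] := eqVneq v v1; first by rewrite h1 mxE maxxx mul0r.
have [->|vv2] := eqVneq v v2; first by rewrite h2 mxE oppr0 maxxx mul0r.
exact: page_weight_out.
Qed.

Lemma third_page_carrier (K : {set {set V}}) t :
  (forall s t : {set V}, s \in K -> t \subset s -> t \in K) -> v3 |: r \in K ->
  0 <= t -> t <= n%:R^-1 -> carrier K (third_page t).
Proof.
move=> Ks F3 t0 tn; have n0 : 0 < n%:R^-1 :> R by rewrite invr_gt0 ltr0n.
have e3 : e ord0 != v3 by apply: contraNneq v3r => <-; exact: e_in_r.
apply: weights_carrier Ks F3 _ _ _ => [v||v].
- rewrite page_weight0; have [->|ve] := eqVneq v (e ord0).
    by rewrite e_in_r (negbTE e3) addr0 subr_ge0.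
  rewrite subr0 addr_ge0 //; first by case: ifP => _ //; exact: ltW.
  by case: ifP.
- by rewrite sumrB big_split /= !sum_page page_weight_sum addrK.
rewrite !inE negb_or page_weight0 => /andP[/negbTE -> /negbTE vr].
by rewrite vr addr0 ifF ?subr0 //; apply: contraFF vr => /eqP ->; exact: e_in_r.
Qed.

Lemma third_page_dist t : 0 <= t -> `|third_page t - page 0| <= 2 * t.
Proof.
move=> t0; apply: norm_le => [|k]; first by rewrite mulr_ge0.
have dE (a b c : R) : a + b - c - a = b - c by ring.
rewrite !mxE dE; apply: le_trans (ler_normB _ _) _; rewrite mulr2n mulrDl mul1r.
by apply: lerD; case: ifP => _; rewrite ?normr0 // ger0_norm.
Qed.

(** By invariance of domain the first two pages already cover a neighbourhood of the image of the
    barycenter. A point of page v3 close to it would then coincide with a point of those pages,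
    although its weight at v3 is positive. *)
Lemma book_not_in_ball (K : {set {set V}}) :
  (forall s t : {set V}, s \in K -> t \subset s -> t \in K) ->
  v1 |: r \in K -> v2 |: r \in K -> v3 |: r \in K ->
  ~ homeomorphic (@carrier R V K) (@unit_ball R n).
Proof.
move=> Ks F1 F2 F3 [h [g [/within_cont_on hc /within_cont_on gc hB gA [hg gh]]]].
have hBx x : carrier K x -> @unit_ball R n (h x) by move=> xK; apply: hB; exists x.
have pK u : Q u -> carrier K (page u) by exact: page_carrier.
have hgK x : carrier K x -> g (h x) = x by move=> xK; exact: hg (mem_set xK).
pose f := h \o page; pose g' := page_coord \o g.
have fc : cont_on Q f by apply: cont_on_comp pK (page_cont (A := Q)) hc.
have gc' : cont_on (@unit_ball R n) g'.
  by apply: (cont_on_comp (B := carrier K)) gc (page_coord_cont (A := carrier K)) => y yB; apply: gA; exists y.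
have fB u : Q u -> @unit_ball R n (f u) by move=> /pK; exact: hBx.
have gf u : Q u -> g' (f u) = u.
  by move=> uQ; rewrite /g' /f /= hgK ?page_coordK //; exact: pK.
have [rho rho0 Hrho] := invariance_of_domain fc gc' fB gf.
have Q0 : Q 0 by rewrite /= normr0.
have [de de0 Hde] := hc _ (pK 0 Q0) rho rho0.
have n0 : 0 < n%:R^-1 :> R by rewrite invr_gt0 ltr0n.
(* The point is at distance at most 2t < de from the barycenter, and t <= 1/n keeps the weight of
   [e ord0] nonnegative. *)
pose t := Num.min (de / 4) n%:R^-1.
have t0 : 0 < t by rewrite lt_min n0 divr_gt0.
have tde : t <= de / 4 by rewrite ge_min lexx.
have tK : carrier K (third_page t).
  by apply: third_page_carrier => //; [exact: ltW|rewrite ge_min lexx orbT].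
have td : `|third_page t - page 0| < de.
  by apply: le_lt_trans (third_page_dist (ltW t0)) _; lra.
have [u uQ fu] := Hrho _ (Hde _ tK td).
have /(congr1 (fun x : point => x ord0 (enum_rank v3))) : page u = third_page t.
  by rewrite -(hgK _ tK) -fu hgK //; exact: pK.
rewrite !weightsE page_weight_out ?[v3 == _]eq_sym // page_weight0 (negbTE v3r) eqxx add0r ifF.
  by rewrite subr0 => /esym/eqP; rewrite gt_eqF.
by apply: contraNF v3r => /eqP ->; exact: e_in_r.
Qed.

End Book.

Lemma triangulated_ball_no_branching (R : realType) (V : finType) d (K : {set {set V}}) :
  triangulated_ball R d.+1 K -> pure_complex d.+1 K -> no_branching d.+1 K.
Proof.
move=> [_ hK] Kp r cr; have [_ Ks cF] := pureP Kp.
rewrite leqNgt; apply/negP => /card_gt2P[F1 [F2 [F3 [[h1 h2 h3] [n12 n23 n31]]]]].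
have page F : F \in facets_over K r -> exists v, [/\ v \notin r, F = v |: r & v |: r \in K].
  rewrite in_facets_over => /andP[FF rF].
  have [x xF rE] := ridgeP (cF F FF) rF cr.
  have FE : F = x |: r by rewrite rE finset.setD1K.
  by exists x; rewrite -FE rE !inE eqxx; have [FK _] := facetsP _ _ FF.
have [v1 [v1r E1 K1]] := page _ h1; have [v2 [v2r E2 K2]] := page _ h2.
have [v3 [v3r E3 K3]] := page _ h3.
pose e (i : 'I_d.+1) := enum_val (cast_ord (esym cr) i).
apply: (@book_not_in_ball R V d v1 v2 v3 e r _ _ v1r v2r v3r _ _ _ K) => //.
- by move=> i j /enum_val_inj/cast_ord_inj.
- move=> v; apply/idP/existsP => [vr|[i /eqP <-]]; last exact: enum_valP.
  by exists (cast_ord cr (enum_rank_in vr v)); rewrite /e cast_ordK enum_rankK_in.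
- by apply: contraNneq n12 => v12; rewrite E1 E2 v12.
- by apply: contraNneq n31 => v13; rewrite E1 E3 v13.
- by apply: contraNneq n23 => v23; rewrite E2 E3 v23.
Qed.

Theorem proposition2p7 (R : realType) (V : finType) (d k : nat)
    (B : {set {set V}}) (hk : (k <= d.+1)%N)
    (hB : triangulated_ball R d.+1 B) :
  k_shelled d.+1 k B <-> shellable d.+1 B /\ k_stacked d k B.
Proof.
apply: k_shelledP hk _ => /shelled_by_pure; exact: triangulated_ball_no_branching hB.
Qed.
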